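(* Let $s>\tfrac12$ be real, let $\phi_k^{(s)}$ ($k\in\mathbb{Z}$) be the generalized Wiener rational functions, and let $S^\phi$ denote the $N\times N$ stiffness matrix with entries $S^\phi_{k,l}=\big\langle\phi_k^{(s)},\tfrac{d}{dx}\phi_l^{(s)}\big\rangle$. Then: 1. $S^\phi$ is skew-Hermitian, i.e. $S^\phi_{k,l}=-\overline{S^\phi_{l,k}}$. 2. $S^\phi$ is sparse: with $k^\vee=\mathrm{sgn}(k)(|k|-1)=k-\mathrm{sgn}(k)$ and $k^\wedge=\mathrm{sgn}(k)(|k|+1)=k+\mathrm{sgn}(k)$, for every $k\in\mathbb{Z}$ $$\frac{d\phi_k^{(s)}(x)}{dx}=\sum_{l\in\{\pm k^\vee,\pm k,\pm k^\wedge\}}\tau_{k,l}^{(s)}\,\phi_l^{(s)}(x)$$ for some purely imaginary constants $\tau_{k,l}^{(s)}$; in other words, $S^\phi_{k,l}=0$ whenever $l\notin\{\pm k^\vee,\pm k,\pm k^\wedge\}$. 3. The spectral radius of $S^\phi$ satisfies $\rho(S^\phi)\le N+5s$.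
   Context: For $\alpha,\beta>-1$ and $n\in\mathbb{N}_0$, $\tilde P_n^{(\alpha,\beta)}$ is the classical Jacobi polynomial $P_n^{(\alpha,\beta)}$ divided by its norm in $L^2([-1,1];(1-r)^\alpha(1+r)^\beta)$. For $s>\tfrac12$, $k\in\mathbb{Z}$, $x\in\mathbb{R}$ define $$\Phi_k^{(s)}(x)=\begin{cases}\dfrac1{\sqrt2}\tilde P_0^{(-1/2,s-3/2)}\Big(\dfrac{1-x^2}{1+x^2}\Big), & k=0,\\[2mm] \dfrac12\Big[\tilde P_{|k|}^{(-1/2,s-3/2)}\Big(\dfrac{1-x^2}{1+x^2}\Big)+\dfrac{2ix\,\mathrm{sgn}(k)}{x^2+1}\tilde P_{|k|-1}^{(1/2,s-1/2)}\Big(\dfrac{1-x^2}{1+x^2}\Big)\Big], & k\ne0,\end{cases}$$ and $\phi_k^{(s)}(x)=\dfrac{2^{s/2}}{(x-i)^s}\Phi_k^{(s)}(x)$, where $(x-i)^{-s}=(1+x^2)^{-s/2}\exp[\tfrac{is}{2}(\pi-2\arctan x)]$ (principal branch). The inner product is $\langle f,g\rangle=\int_{\mathbb{R}}f\,\overline g\,dx$. In the definition of $k^\vee,k^\wedge$ for $k=0$ the convention $\mathrm{sgn}(0)=1$ is used, so that $\{\pm k^\vee,\pm k,\pm k^\wedge\}=\{-1,0,1\}$ when $k=0$. Sums over an index set count each distinct index once. The rows and columns of the $N\times N$ matrix ($N\ge1$) are indexed by a set of $N$ consecutive integers contained in $\{-\lfloor N/2\rfloor,\dots,\lfloor N/2\rfloor\}$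 (for odd $N$ this is $|k|\le (N-1)/2$). *)

(* Defs.v *)
From HB Require Import structures.
From mathcomp Require Import all_boot all_order all_algebra.
From mathcomp Require Import all_classical all_reals all_analysis.
From mathcomp Require Export complex.

Set Implicit Arguments.
Unset Strict Implicit.
Unset Printing Implicit Defensive.

Import Order.TTheory GRing.Theory Num.Theory.
Import numFieldNormedType.Exports.

Local Open Scope classical_set_scope.
Local Open Scope ring_scope.
Local Open Scope complex_scope.

(* [R[i]] carries no topology in the library, so derivatives and integrals of
   complex-valued functions of a real variable are taken componentwise. *)

Definition is_cderive (R : realType) (f : R -> R[i]) (x : R) (df : R[i]) :
    Prop :=
  is_derive x 1 (fun t => complex.Re (f t)) (complex.Re df) /\
  is_derive x 1 (fun t => complex.Im (f t)) (complex.Im df).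

Definition cderive (R : realType) (f : R -> R[i]) (x : R) : R[i] :=
  derive1 (fun t => complex.Re (f t)) x +i*
  derive1 (fun t => complex.Im (f t)) x.

Definition cintegral (R : realType) (f : R -> R[i]) : R[i] :=
  (\int[@lebesgue_measure R]_(x in setT) complex.Re (f x)) +i*
  (\int[@lebesgue_measure R]_(x in setT) complex.Im (f x)).

Definition inner (R : realType) (f g : R -> R[i]) : R[i] :=
  cintegral (fun x => f x * (g x)^*).

(* The matrices of interest have positive size, so the set is finite and
   nonempty and [sup] is its maximum. *)
Definition spectral_radius (R : realType) (n : nat) (A : 'M[R[i]]_n) : R :=
  sup [set complex.Re `|z| | z in [set z : R[i] | eigenvalue A z]].

Definition gbinom (R : realType) (a : R) (k : nat) : R :=
  (\prod_(j < k) (a - j%:R)) / (k`!)%:R.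

(* The formula of Szego, Orthogonal Polynomials, (4.3.2):
     P_n(r) = sum_k C(n+a, n-k) C(n+b, k) ((r-1)/2)^k ((r+1)/2)^(n-k);
   it needs no restriction on a + b. *)
Definition jacobi (R : realType) (a b : R) (n : nat) : {poly R} :=
  \sum_(k < n.+1) (gbinom (n%:R + a) (n - k) * gbinom (n%:R + b) k) *:
     ((2^-1 *: ('X - 1)) ^+ k * (2^-1 *: ('X + 1)) ^+ (n - k)).

(* At an endpoint where its exponent is negative the library gives [powR] the
   value 0; this concerns a null set only. *)
Definition jacobi_norm (R : realType) (a b : R) (n : nat) : R :=
  Num.sqrt (\int[@lebesgue_measure R]_(r in `[(-1 : R), 1])
     ((jacobi a b n).[r] ^+ 2 * ((1 - r) `^ a * (1 + r) `^ b))).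

Definition njacobi (R : realType) (a b : R) (n : nat) (r : R) : R :=
  (jacobi a b n).[r] / jacobi_norm a b n.

Definition wiener_Phi (R : realType) (s : R) (k : int) (x : R) : R[i] :=
  let r := (1 - x ^+ 2) / (1 + x ^+ 2) in
  if k == 0 then ((Num.sqrt 2)^-1 * njacobi (- (1 / 2)) (s - 3 / 2) 0 r)%:C
  else (1 / 2)%:C *
    ((njacobi (- (1 / 2)) (s - 3 / 2) `|k|%N r)%:C +
     (0 +i* (2 * x * (Num.sg k)%:~R / (x ^+ 2 + 1))) *
     (njacobi (1 / 2) (s - 1 / 2) (`|k|%N - 1)%N r)%:C).

(* (x - i)^(-s), principal branch. *)
Definition xmi_powN (R : realType) (s x : R) : R[i] :=
  let t := s / 2 * (pi - 2 * atan x) in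
  ((1 + x ^+ 2) `^ (- (s / 2)))%:C * (cos t +i* sin t).

Definition wiener_phi (R : realType) (s : R) (k : int) (x : R) : R[i] :=
  (2 `^ (s / 2))%:C * xmi_powN s x * wiener_Phi s k x.

(* The sign with the convention sgn(0) = 1. *)
Definition sgn1 (k : int) : int := if k < 0 then -1 else 1.

Definition kvee (k : int) : int := sgn1 k * (`|k| - 1).

Definition kwedge (k : int) : int := sgn1 k * (`|k| + 1).

(* The index set {±k^vee, ±k, ±k^wedge}, each element listed once. *)
Definition nbrs (k : int) : seq int :=
  undup [:: kvee k; - kvee k; k; - k; kwedge k; - kwedge k].

(* Row or column i of a matrix whose indices are the consecutive integers
   k0, k0 + 1, ... *)
Definition idx (N : nat) (k0 : int) (i : 'I_N) : int := k0 + (i : nat)%:Z.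

Definition stiffness (R : realType) (s : R) (N : nat) (k0 : int) :
    'M[R[i]]_N :=
  \matrix_(i, j) inner (wiener_phi s (idx k0 i))
                       (cderive (wiener_phi s (idx k0 j))).

(* Main.v *)
Require Import Defs.
From HB Require Import structures.
From mathcomp Require Import all_boot all_order all_algebra.
From mathcomp Require Import all_classical all_reals all_analysis.
From mathcomp Require Import measurable_realfun.
From mathcomp Require Import ring lra zify.

(* Put x = tan (t/2), so that r = cos t = (1-x^2)/(1+x^2) and
   sin t = 2x/(1+x^2).  Real combinations of the phi_k are the functions
   w (e(r) + i sin t o(r)) with w = 2^(s/2) (x-i)^(-s) and e, o real polynomials,
   and d/dx acts on such pairs (e, o) as i A with A real.  The inner product
   becomes L (e e' + (1-r^2) o o'), where L f = \int f(r) |w|^2 dx.  Everything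
   about L follows from one integration by parts (the Pearson identity): the
   Jacobi polynomials are orthogonal, hence the phi_k are orthonormal, and A is
   symmetric.  As A raises degrees by at most one, symmetry makes it banded, and
   S_(k,l) = - i <phi_k, A phi_l>.  For (e, o) of degree at most m, e' satisfies
   L ((1-r^2) e'^2) <= (m+s)^2 L (e^2) because the Jacobi polynomials are
   eigenfunctions for n (n+s-1), so |<F, A F>| <= (2m + 7s/2) |F|^2; here
   m = floor (N/2), which gives the bound N + 5s on the spectral radius. *)

Set Implicit Arguments.
Unset Strict Implicit.
Unset Printing Implicit Defensive.

Import Order.TTheory GRing.Theory Num.Theory.
Local Open Scope ring_scope.

(** * Jacobi polynomials *)

(** The obstacle is analytic: the Jacobi weight is singular at the endpoints, whereas on the line
    the weight |w|^2 is smooth and the boundary terms decay. So the integration by parts is done in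
    the variable x, and everything about Jacobi polynomials becomes algebra for an abstract linear
    functional on polynomials. Multiplying by 1-r^2 raises both exponents by one and keeps the
    Pearson form, which is what the inductions need. Integrals over [-1, 1] enter only through the
    Jacobi norms, that is through squares, and for these monotone convergence suffices in the change
    of variable. For the spectral bound, integration by parts trades the derivative of o for that of
    e in <F, A F>, so that a single derivative estimate is used. The constant is 2(m+s) from the
    term with e', plus s/2 and s from the two terms without derivatives. *)

Lemma gbinomS (R : realType) (x : R) (m : nat) :
  m.+1%:R * gbinom x m.+1 = (x - m%:R) * gbinom x m.
Proof.
rewrite /gbinom big_ord_recr/= factS natrM invfM.
by rewrite mulrCA mulVKf ?pnatr_eq0// mulrAC mulrC.
Qed.

Definition jcoef (R : realType) (a b : R) (n k : nat) : R :=
  gbinom (n%:R + a) (n - k) * gbinom (n%:R + b) k.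

(** With u = (r-1)/2 and v = (r+1)/2, both u^(k+1) v^(n-k) and u^k v^(n+1-k) have a multiple of u^k
    v^(n-k) in their derivative; the left side collects the two coefficients. *)
Lemma jcoef_deriv (R : realType) (a b : R) (n k : nat) : (k <= n)%N ->
  k.+1%:R * jcoef a b n.+1 k.+1 + (n.+1 - k)%:R * jcoef a b n.+1 k =
  (n.+1%:R + a + b + 1) * jcoef (a + 1) (b + 1) n k.
Proof.
move=> kn; rewrite /jcoef subSS subSn//.
have -> : n%:R + (a + 1) = n.+1%:R + a by rewrite -[n.+1]addn1 natrD; ring.
have -> : n%:R + (b + 1) = n.+1%:R + b by rewrite -[n.+1]addn1 natrD; ring.
rewrite mulrCA gbinomS mulrA gbinomS natrB//.
by rewrite -[n.+1]addn1 natrD; ring.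
Qed.

Lemma jcoef_rodrigues_l (R : realType) (a b : R) (n k : nat) : (k <= n)%N ->
  (k%:R + a + 1) * jcoef (a + 1) (b + 1) n k =
  (n.+1 - k)%:R * jcoef a b n.+1 k.
Proof.
move=> kn; rewrite /jcoef subSn//.
have -> : n%:R + (a + 1) = n.+1%:R + a by rewrite -[n.+1]addn1 natrD; ring.
have -> : n%:R + (b + 1) = n.+1%:R + b by rewrite -[n.+1]addn1 natrD; ring.
rewrite mulrA [in RHS]mulrA gbinomS natrB//.
by rewrite -[n.+1]addn1 natrD; ring.
Qed.

Lemma jcoef_rodrigues_r (R : realType) (a b : R) (n k : nat) : (k <= n)%N ->
  ((n - k)%:R + b + 1) * jcoef (a + 1) (b + 1) n k =
  k.+1%:R * jcoef a b n.+1 k.+1.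
Proof.
move=> kn; rewrite /jcoef subSS.
have -> : n%:R + (a + 1) = n.+1%:R + a by rewrite -[n.+1]addn1 natrD; ring.
have -> : n%:R + (b + 1) = n.+1%:R + b by rewrite -[n.+1]addn1 natrD; ring.
rewrite [in RHS]mulrCA gbinomS natrB//.
by rewrite -[n.+1]addn1 natrD; ring.
Qed.

Section Jacobi.
Variable R : realType.
Implicit Types (a b : R) (n k : nat).

Let u : {poly R} := 2^-1 *: ('X - 1).
Let v : {poly R} := 2^-1 *: ('X + 1).

Let derivu : u^`() = (2^-1)%:P.
Proof. by rewrite derivZ derivB derivX derivC subr0 alg_polyC. Qed.

Let derivv : v^`() = (2^-1)%:P.
Proof. by rewrite derivZ derivD derivX derivC addr0 alg_polyC. Qed.

Let jacobiE a b n :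
  jacobi a b n = \sum_(k < n.+1) jcoef a b n k *: (u ^+ k * v ^+ (n - k)).
Proof. by []. Qed.

Lemma jacobi_deriv a b n : (jacobi a b n.+1)^`() =
  ((n.+1%:R + a + b + 1) / 2) *: jacobi (a + 1) (b + 1) n.
Proof.
rewrite !jacobiE raddf_sum/=.
under eq_bigr => k _.
  rewrite derivZ derivM !deriv_exp derivu derivv scalerDr.
  over.
rewrite big_split/= big_ord_recl/= mulr0n mul0r scaler0 add0r.
rewrite [X in _ + X]big_ord_recr/= subnn mulr0n mulr0 scaler0 addr0.
rewrite -big_split/= scaler_sumr; apply: eq_bigr => -[k /= kn] _.
rewrite ltnS in kn; rewrite /bump/= add1n subSS.
rewrite subSn//= scalerA mulrAC -jcoef_deriv// subSn//.
rewrite -!mul_polyC -[_ *+ k.+1]mulr_natr -[_ *+ (n - k).+1]mulr_natr.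
rewrite !polyCM polyCD !polyCM !polyC_natr.
ring.
Qed.

(** One step of the Rodrigues formula: the left side is the derivative of (1-r)^(a+1) (1+r)^(b+1)
    P_n^(a+1,b+1), divided by (1-r)^a (1+r)^b. In u and v it becomes an identity of coefficients,
    because 1-r = -2u and 1+r = 2v. *)
Lemma jacobi_rodrigues a b n :
  (1 - 'X^2) * (jacobi (a + 1) (b + 1) n)^`() +
    ((b + 1) *: (1 - 'X) - (a + 1) *: (1 + 'X)) * jacobi (a + 1) (b + 1) n =
  - (2 * n.+1%:R) *: jacobi a b n.+1.
Proof.
have uv : 1 - 'X^2 = - 4%:P * u * v :> {poly R}.
  rewrite /u /v -!mul_polyC.
  have -> : 4%:P = 2%:P * 2%:P :> {poly R} by rewrite -polyCM; congr polyC; ring.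
  have h : 2%:P * (2^-1)%:P = 1 :> {poly R}.
    by rewrite -polyCM divff.
  transitivity (- (2%:P * (2^-1)%:P) * (2%:P * (2^-1)%:P) * (('X - 1) * ('X + 1)) : {poly R}).
    by rewrite h; ring.
  by ring.
have uE : 1 - 'X = - 2%:P * u :> {poly R}.
  by rewrite /u -mul_polyC mulrA -polyCN -polyCM mulNr divff// polyCN; ring.
have vE : 1 + 'X = 2%:P * v :> {poly R}.
  by rewrite /v -mul_polyC mulrA -polyCM divff// ; ring.
rewrite uv uE vE !jacobiE.
set c := jcoef _ _ n.
have h1 : \sum_(k < n.+1) (k%:R * c k) *: (u ^+ k * v ^+ (n - k).+1)
   + \sum_(k < n.+1) ((n - k)%:R * c k) *: (u ^+ k.+1 * v ^+ (n - k))
   = u * v * 2%:P * (\sum_(k < n.+1) c k *: (u ^+ k * v ^+ (n - k)))^`().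
  rewrite raddf_sum/= mulr_sumr -big_split/=; apply: eq_bigr => -[k /= kn] _.
  have h : 2%:P * (2^-1)%:P = 1 :> {poly R} by rewrite -polyCM divff.
  rewrite derivZ derivM !deriv_exp derivu derivv.
  move: (c k) => ck; rewrite -!mul_polyC !polyCM !polyC_natr.
  rewrite -[_ *+ k]mulr_natr -[_ *+ (n - k)]mulr_natr.
  (* For [i = 0] the factor [i%:R] vanishes, so the truncated predecessor does no harm. *)
  have hk (w : {poly R}) i : i%:R * w ^+ i = w * w ^+ i.-1 * i%:R.
    by case: i => [|i]; rewrite ?mul0r ?mulr0// mulrC -exprS.
  transitivity (2%:P * (2^-1)%:P * ck%:P *
   (v ^+ (n - k) * v * (u * u ^+ k.-1 * k%:R) + u ^+ k * u * (v * v ^+ (n - k).-1 * (n - k)%:R))).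
    by rewrite h -!hk !exprSr; ring.
  by ring.
(* At u^k v^(n+1-k) the first sum gives n+1-k times the coefficient of P_(n+1), and the second,
   after an index shift, gives k times it; together n+1. *)
have h2 : \sum_(k < n.+1) ((k%:R + a + 1) * c k) *: (u ^+ k * v ^+ (n - k).+1)
   + \sum_(k < n.+1) (((n - k)%:R + b + 1) * c k) *: (u ^+ k.+1 * v ^+ (n - k))
   = n.+1%:R *: \sum_(k < n.+2) jcoef a b n.+1 k *: (u ^+ k * v ^+ (n.+1 - k)).
  transitivity (\sum_(k < n.+2) ((n.+1 - k)%:R * jcoef a b n.+1 k) *: (u ^+ k * v ^+ (n.+1 - k))
    + \sum_(k < n.+2) (k%:R * jcoef a b n.+1 k) *: (u ^+ k * v ^+ (n.+1 - k))).
    congr (_ + _).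
      rewrite [RHS]big_ord_recr/= subnn mul0r scale0r addr0; apply: eq_bigr => -[k /= kn] _.
      by rewrite jcoef_rodrigues_l// subSn.
    rewrite [RHS]big_ord_recl/= mul0r scale0r add0r; apply: eq_bigr => -[k /= kn] _.
    by rewrite /bump/= add1n jcoef_rodrigues_r// subSS.
  rewrite -big_split/= scaler_sumr; apply: eq_bigr => -[k /= kn] _.
  by rewrite -scalerDl -mulrDl -natrD subnK// scalerA.
have -> : - (2 * n.+1%:R) = (- 2) * n.+1%:R :> R by ring.
rewrite -scalerA -h2 -!mul_polyC polyCN.
have -> : \sum_(k < n.+1) ((k%:R + a + 1) * c k) *: (u ^+ k * v ^+ (n - k).+1) =
  \sum_(k < n.+1) (k%:R * c k) *: (u ^+ k * v ^+ (n - k).+1) + (a + 1)%:P * v * \sum_(k < n.+1) c k *: (u ^+ k * v ^+ (n - k)).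
  rewrite mulr_sumr -big_split/=; apply: eq_bigr => k _.
  by move: (c k) => ck; rewrite -!mul_polyC !polyCM !polyCD exprSr; ring.
have -> : \sum_(k < n.+1) (((n - k)%:R + b + 1) * c k) *: (u ^+ k.+1 * v ^+ (n - k)) =
  \sum_(k < n.+1) ((n - k)%:R * c k) *: (u ^+ k.+1 * v ^+ (n - k)) + (b + 1)%:P * u * \sum_(k < n.+1) c k *: (u ^+ k * v ^+ (n - k)).
  rewrite mulr_sumr -big_split/=; apply: eq_bigr => k _.
  by move: (c k) => ck; rewrite -!mul_polyC !polyCM !polyCD exprSr; ring.
rewrite addrACA h1.
have -> : 4%:P = 2%:P * 2%:P :> {poly R} by rewrite -polyCM; congr polyC; ring.
ring.
Qed.

End Jacobi.

(** * Orthogonality from the Pearson identity *)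

Section Pearson.
Variable R : realType.
Implicit Types (a b : R) (L : {scalar {poly R}}) (n m : nat).

(* [L] behaves like integration against (1-r)^a (1+r)^b on [-1, 1]: the argument
   of [L] times this weight is the derivative of (1-r)^(a+1) (1+r)^(b+1) g. *)
Definition pearson a b L := forall g : {poly R},
  L ((1 - 'X^2) * g^`() + ((b + 1) *: (1 - 'X) - (a + 1) *: (1 + 'X)) * g) = 0.

(** The functional of the weight multiplied by 1-r^2, that is with both exponents raised by one. *)
Definition wshift L (f : {poly R}) : R := L ((1 - 'X^2) * f).

Fact wshift_is_scalar L : scalar (wshift L).
Proof. by move=> c f g; rewrite /wshift mulrDr -scalerAr linearP. Qed.

HB.instance Definition _ L :=
  GRing.isLinear.Build R {poly R} R *%R (wshift L) (wshift_is_scalar L).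

Lemma deriv_1BX2 : (1 - 'X^2)^`() = - 2%:R *: 'X :> {poly R}.
Proof. by rewrite derivB derivC sub0r derivXn/= scaleNr scaler_nat. Qed.

(** The identity for the raised exponents at g is the original one at (1-r^2) g. *)
Lemma pearson_shift a b L :
  pearson a b L -> pearson (a + 1) (b + 1) (wshift L).
Proof.
move=> pL g; rewrite -[RHS](pL ((1 - 'X^2) * g)) /= /wshift; congr (L _).
rewrite derivM deriv_1BX2 -!mul_polyC !polyCD !polyCN polyC_natr polyC1.
by ring.
Qed.

Let LZ L c f : L (c *: f) = c * L f. Proof. exact: linearZ. Qed.

(** Integration by parts: the Pearson identity is applied to P_n^(a+1,b+1) f, and [jacobi_rodrigues]
    turns the part in which f is not differentiated into a multiple of P_(n+1)^(a,b) f. *)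
Lemma jacobi_parts a b L n f : pearson a b L ->
  L (jacobi a b n.+1 * f) =
  (2 * n.+1%:R)^-1 * wshift L (jacobi (a + 1) (b + 1) n * f^`()).
Proof.
move=> /(_ (jacobi (a + 1) (b + 1) n * f)).
set q := jacobi _ _ n => e.
have n0 : 2 * n.+1%:R != 0 :> R by rewrite mulf_neq0 ?pnatr_eq0.
apply: (mulfI n0); rewrite mulVKf// /wshift; apply/eqP.
rewrite eq_sym -subr_eq0 -e addrC -mulNr -LZ -linearD; apply/eqP; congr (L _).
by rewrite scalerAl -jacobi_rodrigues derivM -/q; ring.
Qed.

Lemma jacobi0 a b : jacobi a b 0 = 1.
Proof.
by rewrite /jacobi big_ord1/= /gbinom !big_ord0 fact0 divr1 !mulr1 scale1r.
Qed.

(** Each integration by parts lowers both degrees and raises both exponents, until one factor is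
    constant; the next one differentiates that constant. *)
Lemma jacobi_orth a b L n m : pearson a b L -> n != m ->
  L (jacobi a b n * jacobi a b m) = 0.
Proof.
have step0 a' b' (L' : {scalar {poly R}}) k : pearson a' b' L' ->
    L' (jacobi a' b' k.+1 * jacobi a' b' 0) = 0.
  by move=> p; rewrite jacobi_parts// jacobi0 derivC mulr0 linear0 mulr0.
elim: n m a b L => [|n ih] [|m] a b L pL //= nm.
- by rewrite mulrC step0.
- by rewrite step0.
- rewrite jacobi_parts// jacobi_deriv -scalerAr linearZ/= ih ?mulr0 //.
  exact: pearson_shift.
Qed.

(** The weak form of the Jacobi differential equation, with eigenvalue n (n+a+b+1). It also makes
    the derivatives orthogonal for the shifted functional. *)
Lemma jacobi_dirichlet a b L n m : pearson a b L ->
  wshift L ((jacobi a b n)^`() * (jacobi a b m)^`()) =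
  n%:R * (n%:R + a + b + 1) * L (jacobi a b n * jacobi a b m).
Proof.
move=> pL; case: n => [|n]; first by rewrite jacobi0 derivC !mul0r linear0.
rewrite jacobi_parts// jacobi_deriv -scalerAl linearZ/=.
have n0 : n.+1%:R != 0 :> R by rewrite pnatr_eq0.
move: (n.+1%:R) n0 (wshift L _) => c c0 w.
by field.
Qed.

(* Testing the Pearson identity on 1 and X determines [L X] and [L X^2], and
   (a+b+2) (a+b+3) L(1-X^2) = 4 (a+1) (b+1) L(1). *)
Lemma wshift_gt0 a b L : -1 < a -> -1 < b -> pearson a b L -> 0 < L 1 ->
  0 < wshift L 1.
Proof.
move=> a1 b1 pL L1.
have := pL 1; have := pL 'X.
rewrite /wshift derivX derivC.
rewrite (_ : _ * 1 + _ * 'X = 1 + (b - a) *: 'X - (a + b + 3) *: 'X^2); last first.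
  by rewrite -!mul_polyC !polyCD !polyCN ?polyC1; ring.
rewrite (_ : _ * 0 + _ * 1 = (b - a) *: 1 - (a + b + 2) *: 'X); last first.
  by rewrite -!mul_polyC !polyCD !polyCN ?polyC1; ring.
rewrite mulr1 !raddfB raddfD/= !LZ.
move: (L 1) (L 'X) (L 'X^2) L1 => l0 l1 l2 l0_gt0 e2 e1.
have e : (a + b + 2) * (a + b + 3) * (l0 - l2) = 4 * (a + 1) * (b + 1) * l0.
  have -> : (a + b + 2) * (a + b + 3) * (l0 - l2) =
    4 * (a + 1) * (b + 1) * l0
    + (a + b + 2) * (l0 + (b - a) * l1 - (a + b + 3) * l2)
    + (b - a) * ((b - a) * l0 - (a + b + 2) * l1) by ring.
  by rewrite e1 e2 !mulr0 !addr0.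
have d : 0 < (a + b + 2) * (a + b + 3) by apply: mulr_gt0; lra.
rewrite -(pmulr_rgt0 _ d) e; apply: mulr_gt0 => //.
by apply: mulr_gt0; [apply: mulr_gt0|]; lra.
Qed.

(** The square norm of P_(n+1) is a positive multiple of that of P_n with raised exponents, so
    positivity descends to that of the functional at 1, which [wshift_gt0] carries along. *)
Lemma jacobi_sqr_gt0 a b L n : -1 < a -> -1 < b -> pearson a b L -> 0 < L 1 ->
  0 < L (jacobi a b n * jacobi a b n).
Proof.
elim: n a b L => [|n ih] a b L a1 b1 pL L1; first by rewrite jacobi0 mulr1.
rewrite jacobi_parts// jacobi_deriv -scalerAr linearZ/=.
have n1 : 1 <= n.+1%:R :> R by rewrite ler1n.
apply: mulr_gt0; first by rewrite invr_gt0; lra.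
apply: mulr_gt0; first by lra.
apply: ih; [lra|lra|exact: pearson_shift|exact: (wshift_gt0 a1 b1 pL L1)].
Qed.

(** The leading coefficient is followed through [jacobi_deriv], whose factor n+a+b+2 is positive
    since a, b > -1 and n >= 0. *)
Lemma jacobi_coef_neq0 a b n : -1 < a -> -1 < b -> (jacobi a b n)`_n != 0.
Proof.
elim: n a b => [|n ih] a b a1 b1; first by rewrite jacobi0 coef1 oner_eq0.
apply/eqP => e; have := coef_deriv (jacobi a b n.+1) n.
rewrite e mul0rn jacobi_deriv coefZ => /eqP; rewrite mulf_eq0.
rewrite (negbTE (ih _ _ _ _)) ?orbF; [|lra|lra].
have n1 : 1 <= n.+1%:R :> R by rewrite ler1n.
by rewrite gt_eqF//; lra.
Qed.

Lemma size_jacobi_le a b n : (size (jacobi a b n) <= n.+1)%N.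
Proof.
apply: (leq_trans (size_sum _ _ _)); apply/bigmax_leqP => -[k /= kn] _.
have h c : (size (2^-1 *: ('X + c%:P) : {poly R}) <= 2)%N.
  by rewrite (leq_trans (size_scale_leq _ _))// size_XaddC.
apply: (leq_trans (size_scale_leq _ _)).
apply: (leq_trans (size_polyMleq _ _)).
have h' c i : (size ((2^-1 *: ('X + c%:P) : {poly R}) ^+ i) <= i.+1)%N.
  apply: (leq_trans (size_poly_exp_leq _ _)); rewrite ltnS.
  by rewrite -[leqRHS]mul1n leq_mul2r -ltnS; case: size (h c) => [|[|[]]]; rewrite ?orbT.
have := h' (-1) k; have := h' 1 (n - k)%N; rewrite polyCN polyC1.
move: (size _) (size _) => x y.
lia.
Qed.

End Pearson.

(** * Pairs of polynomials *)

Lemma jacobi_span (R : realType) (a b : R) (m : nat) (e : {poly R}) :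
  -1 < a -> -1 < b -> (size e <= m)%N ->
  exists c : nat -> R, e = \sum_(n < m) c n *: jacobi a b n.
Proof.
move=> a1 b1; elim: m e => [|m ih] e em.
  exists (fun=> 0); rewrite big_ord0; apply/eqP.
  by rewrite -size_poly_eq0 -leqn0.
pose d := e`_m / (jacobi a b m)`_m.
have [|c ce] := ih (e - d *: jacobi a b m).
  apply/leq_sizeP => j mj; rewrite coefB coefZ.
  have [<-|jm] := eqVneq m j; first by rewrite /d divfK ?subrr// jacobi_coef_neq0.
  have {jm mj} mj : (m < j)%N by rewrite ltn_neqAle jm.
  rewrite nth_default ?(leq_trans em)// nth_default ?mulr0 ?subr0//.
  exact: leq_trans (size_jacobi_le _ _ _) mj.
exists (fun n => if n == m then d else c n); rewrite big_ord_recr/= eqxx.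
rewrite -[LHS](subrK (d *: jacobi a b m)) ce; congr (_ + _).
by apply: eq_bigr => i _; rewrite ltn_eqF.
Qed.

Lemma size_deriv_le (R : nzRingType) (e : {poly R}) (m : nat) :
  (size e <= m.+1)%N -> (size e^`() <= m)%N.
Proof.
move=> em; have [->|e0] := eqVneq e 0; first by rewrite deriv0 size_poly0.
by rewrite -ltnS (leq_trans (lt_size_deriv e0)).
Qed.

Section Pairs.
Variables (R : realType) (s : R) (L : {scalar {poly R}}).
Implicit Types (F G : {poly R} * {poly R}) (c : R) (f g e : {poly R}).

(* The pair (e, o) stands for the function w(x) (e(r) + i sin t o(r)). *)
Definition pair_form F G : R := L (F.1 * G.1) + wshift L (F.2 * G.2).

(* - i d/dx in these coordinates. *)
Definition pair_op F : {poly R} * {poly R} :=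
  ((1 + 'X) * ('X * F.2 - (1 - 'X^2) * F.2^`())
     - (s / 2) *: ((1 - 'X^2) * F.2) - (s / 2) *: ((1 + 'X) * F.1),
   (1 + 'X) * F.1^`() + (s / 2) *: F.1 - (s / 2) *: ((1 + 'X) * F.2)).

Lemma scalarLZ (L' : {scalar {poly R}}) c f : L' (c *: f) = c * L' f.
Proof. exact: linearZ. Qed.

Lemma pair_formC F G : pair_form F G = pair_form G F.
Proof. by rewrite /pair_form mulrC [F.2 * _]mulrC. Qed.

Lemma pair_formP c F F' G :
  pair_form (c *: F + F') G = c * pair_form F G + pair_form F' G.
Proof.
rewrite /pair_form /= !mulrDl -!scalerAl !raddfD/= !scalarLZ.
by ring.
Qed.

Lemma pair_form_suml (I : Type) (r : seq I) (x : I -> R)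
    (Fs : I -> {poly R} * {poly R}) G :
  pair_form (\sum_(i <- r) x i *: Fs i) G = \sum_(i <- r) x i * pair_form (Fs i) G.
Proof.
elim: r => [|i r ih].
  by rewrite !big_nil /pair_form/= !mul0r !linear0 addr0.
by rewrite !big_cons pair_formP ih.
Qed.

Lemma pair_form_sumr (I : Type) (r : seq I) (x : I -> R)
    (Fs : I -> {poly R} * {poly R}) F :
  pair_form F (\sum_(i <- r) x i *: Fs i) = \sum_(i <- r) x i * pair_form F (Fs i).
Proof.
rewrite pair_formC pair_form_suml//.
by apply: eq_bigr => i _; rewrite pair_formC.
Qed.

Lemma pair_opP c F G : pair_op (c *: F + G) = c *: pair_op F + pair_op G.
Proof.
rewrite /pair_op /=; congr (_, _) => /=; rewrite !derivD !derivZ -!mul_polyC.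
  by ring.
by ring.
Qed.

Lemma pair_op_sum (I : Type) (r : seq I) (x : I -> R)
    (Fs : I -> {poly R} * {poly R}) :
  pair_op (\sum_(i <- r) x i *: Fs i) = \sum_(i <- r) x i *: pair_op (Fs i).
Proof.
elim: r => [|i r ih]; last by rewrite !big_cons pair_opP ih.
by rewrite !big_nil /pair_op/= !deriv0 !(mulr0, scaler0, subr0, addr0).
Qed.

Hypothesis pL : pearson (- (1 / 2)) (s - 3 / 2) L.

Let t : {poly R} := (s / 2)%:P.

(** Here a+1 = 1/2 and b+1 = s - 1/2, so the second factor collapses to s - 1 - s r. Writing s/2 as
    the constant polynomial [t] lets [ring] treat it as an atom. *)
Let pL' g : L ((1 - 'X^2) * g^`() + (t + t - 1 - (t + t) * 'X) * g) = 0.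
Proof.
rewrite -[RHS](pL g); congr (L (_ + _ * _)).
rewrite -!mul_polyC /t.
have -> : s - 3 / 2 + 1 = s / 2 + s / 2 - 1 / 2 by field.
have -> : - (1 / 2) + 1 = 1 / 2 :> R by field.
have h : (1 / 2)%:P + (1 / 2)%:P = 1 :> {poly R}.
  by rewrite -polyCD -[RHS]polyC1; congr polyC; field.
rewrite polyCB polyCD -[X in _ + _ - X - _]h; ring.
Qed.

(** The two sides differ by Pearson identities: the one for (1+r) o' e minus the one for (1+r) o e',
    where the prime marks the components of [G]. *)
Lemma pair_op_sym F G : pair_form (pair_op F) G = pair_form F (pair_op G).
Proof.
case: F G => [e o] [e' o']; apply/eqP; rewrite -subr_eq0; apply/eqP.
have := pL' ((1 + 'X) * (o * e')); have := pL' ((1 + 'X) * (o' * e)) => h1 h2.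
rewrite -[RHS](subrr 0) -{1}h1 -h2.
rewrite /pair_form /wshift /= -!raddfD/= -!raddfB/=; congr (L _).
rewrite !derivM !derivD !derivX !derivC -!mul_polyC -/t.
by ring.
Qed.

(** Adding the Pearson identity for (1+r) o e cancels the derivative of o and doubles the term with
    the derivative of e. *)
Lemma pair_op_quad F : pair_form F (pair_op F) =
  2 * L ((1 - 'X^2) * ((1 + 'X) * (F.1^`() * F.2)))
  + s * L ((1 - 'X^2) * (F.1 * F.2))
  - s / 2 * L ((1 + 'X) * (F.1 ^+ 2 + (1 - 'X^2) * F.2 ^+ 2)).
Proof.
case: F => [e o] /=.
rewrite -[LHS]addr0 -(pL' ((1 + 'X) * (o * e))).
rewrite /pair_form /wshift -!scalarLZ /= -!raddfD/= -!raddfB/=; congr (L _).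
rewrite !derivM !derivD !derivX !derivC -!mul_polyC -/t.
have -> : s%:P = t + t by rewrite /t -polyCD; congr polyC; field.
rewrite polyC_natr.
by ring.
Qed.

Hypothesis s12 : 1 / 2 < s.
Hypothesis L0 : 0 < L 1.
Hypothesis Lge0 : forall f, (forall r, -1 <= r <= 1 -> 0 <= f.[r]) -> 0 <= L f.

Let s0 : 0 < s. Proof. by have := s12; lra. Qed.
Let a1 : -1 < - (1 / 2) :> R. Proof. by lra. Qed.
Let b1 : -1 < s - 3 / 2 :> R. Proof. by have := s12; lra. Qed.

(** Both sides are diagonal in the Jacobi basis, with ratio n (n+s-1) for n <= m. This is weakened
    to a square because its root serves as the weight in Young's inequality. *)
Lemma pair_markov e m : (size e <= m.+1)%N ->
  wshift L (e^`() * e^`()) <= (m%:R + s) ^+ 2 * L (e * e).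
Proof.
move=> /(jacobi_span a1 b1)[c ->].
have diag (L' : {scalar {poly R}}) (f : nat -> {poly R}) :
    (forall i j, i != j -> L' (f i * f j) = 0) ->
    L' ((\sum_(n < m.+1) c n *: f n) * (\sum_(n < m.+1) c n *: f n)) =
    \sum_(n < m.+1) c n ^+ 2 * L' (f n * f n).
  move=> orth; rewrite mulr_suml raddf_sum/=; apply: eq_bigr => i _.
  rewrite mulr_sumr raddf_sum/= (bigD1 i)//= big1 ?addr0.
    by rewrite -scalerAl -scalerAr !scalarLZ mulrA expr2.
  move=> j ji; rewrite -scalerAl -scalerAr !scalarLZ orth ?mulr0//.
  by rewrite eq_sym.
rewrite raddf_sum/=; under eq_bigr do rewrite derivZ.
rewrite (diag _ (fun n => (jacobi (- (1 / 2)) (s - 3 / 2) n)^`())); last first.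
  by move=> i j ij; rewrite /= jacobi_dirichlet// jacobi_orth ?mulr0.
rewrite (diag _ (jacobi (- (1 / 2)) (s - 3 / 2))); last by move=> i j ij; rewrite jacobi_orth.
rewrite mulr_sumr; apply: ler_sum => -[n /= nm] _.
rewrite jacobi_dirichlet// [leRHS]mulrCA; apply: ler_wpM2l; first exact: sqr_ge0.
apply: ler_wpM2r; first by rewrite ltW// jacobi_sqr_gt0.
rewrite ltnS in nm; have nm' : n%:R <= m%:R :> R by rewrite ler_nat.
have n0 : 0 <= n%:R :> R by [].
have -> : n%:R + - (1 / 2) + (s - 3 / 2) + 1 = n%:R + s - 1 :> R by field.
apply: (@le_trans _ _ (n%:R * (n%:R + s))).
  by have := s0 => ?; apply: ler_wpM2l => //; lra.
by have := s0 => ?; rewrite expr2; apply: ler_pM => //; lra.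
Qed.

Lemma norm_functional_le f g :
  (forall r, -1 <= r <= 1 -> `|f.[r]| <= g.[r]) -> `|L f| <= L g.
Proof.
move=> fg; rewrite ler_norml; apply/andP; split.
  rewrite -subr_ge0 opprK -raddfD Lge0// => r /fg.
  by rewrite hornerD ler_norml -subr_ge0 opprK => /andP[].
rewrite -subr_ge0 -raddfB Lge0// => r /fg.
by rewrite hornerD hornerN ler_norml subr_ge0 => /andP[].
Qed.

(** The three terms of [pair_op_quad] are at most 2(m+s), s/2 and s times the square norm of [F], in
    absolute value. *)
Lemma pair_op_bound F m : (size F.1 <= m.+1)%N ->
  `|pair_form F (pair_op F)| <= (2 * m%:R + 7 / 2 * s) * pair_form F F.
Proof.
case: F => [e o] /= em; rewrite pair_op_quad /pair_form/=.
have := pair_markov em.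
set k := m%:R + s.
have k0 : 0 < k by rewrite /k ltr_wpDl.
rewrite /wshift => mk.
have k0' : k^-1 * k = 1 by rewrite mulVf// gt_eqF.
have hX2 r : (1 - 'X^2 : {poly R}).[r] = 1 - r ^+ 2 by rewrite !hornerE.
have kl : k^-1 * L ((1 - 'X^2) * (e^`() * e^`())) <= k * L (e * e).
  by rewrite ler_pdivrMl// [leRHS]mulrA -(expr2 k).
have r2 r : -1 <= r <= 1 -> 0 <= 1 - r ^+ 2 :> R by move=> /andP[? ?]; nra.
(* The bound 1+r <= 2 cancels the 1/2 of Young's inequality. With x the derivative of e, the weight
   k = m+s is the one for which [kl] returns k L(e^2). *)
have young r x y : -1 <= r <= 1 ->
    `|(1 + r) * (x * y)| <= k^-1 * x ^+ 2 + k * y ^+ 2.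
  move=> /andP[r1 r1'].
  have h (z : R) : 2 * (x * z) <= k^-1 * x ^+ 2 + k * z ^+ 2.
    rewrite -subr_ge0 (_ : _ - _ = k^-1 * (x - k * z) ^+ 2).
      by rewrite mulr_ge0 ?sqr_ge0// invr_ge0 ltW.
    by field; rewrite gt_eqF.
  rewrite normrM (@le_trans _ _ (2 * `|x * y|))//.
    by rewrite ler_wpM2r// ger0_norm; lra.
  have := h y; have := h (- y); rewrite sqrrN mulrN => h1 h2.
  by rewrite -[2]ger0_norm// -normrM ler_norml; apply/andP; split; lra.
have B1 : `|L ((1 - 'X^2) * ((1 + 'X) * (e^`() * o)))| <=
  k^-1 * L ((1 - 'X^2) * (e^`() * e^`())) + k * L ((1 - 'X^2) * (o * o)).
  rewrite -!scalarLZ -raddfD; apply: norm_functional_le => r r1.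
  rewrite hornerD !hornerZ !(hornerM (1 - 'X^2)) hX2 normrM ger0_norm ?r2//.
  rewrite [k^-1 * _]mulrCA [k * _]mulrCA -mulrDr ler_wpM2l ?r2//.
  rewrite !hornerM hornerD hornerX -polyC1 hornerC -!expr2; exact: young.
have B2 : `|L ((1 - 'X^2) * (e * o))| <=
  2^-1 * (L (e * e) + L ((1 - 'X^2) * (o * o))).
  rewrite -raddfD -scalarLZ; apply: norm_functional_le => r r1.
  rewrite hornerZ hornerD !hornerM hX2.
  have := r2 r r1; have := sqr_ge0 r.
  move: (r ^+ 2) e.[r] o.[r] => z x y z0 z1.
  have := mulr_ge0 z0 (sqr_ge0 x).
  have := mulr_ge0 z1 (sqr_ge0 (x - y)); have := mulr_ge0 z1 (sqr_ge0 (x + y)).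
  rewrite !expr2 ler_norml => *; apply/andP; split; lra.
have B3 : 0 <= L ((1 + 'X) * (e ^+ 2 + (1 - 'X^2) * o ^+ 2)) <=
  2 * (L (e * e) + L ((1 - 'X^2) * (o * o))).
  have h r : (e ^+ 2 + (1 - 'X^2) * o ^+ 2).[r] =
      e.[r] ^+ 2 + (1 - r ^+ 2) * o.[r] ^+ 2.
    by rewrite hornerD (hornerM (1 - 'X^2)) hX2 !horner_exp.
  have h0 r : -1 <= r <= 1 -> 0 <= e.[r] ^+ 2 + (1 - r ^+ 2) * o.[r] ^+ 2.
    by move=> r1; apply: addr_ge0; [|apply: mulr_ge0]; rewrite ?sqr_ge0 ?r2.
  have hX r : (1 + 'X : {poly R}).[r] = 1 + r by rewrite !hornerE.
  apply/andP; split.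
    apply: Lge0 => r r1; rewrite hornerM h hX mulr_ge0 ?h0//.
    by case/andP: r1 => *; lra.
  rewrite -raddfD/= -scalarLZ -subr_ge0 -raddfB; apply: Lge0 => r r1.
  rewrite hornerD hornerN hornerZ hornerM -!expr2 h hX -mulrBl mulr_ge0 ?h0//.
  by case/andP: r1 => *; lra.
have ee : 0 <= L (e * e).
  by apply: Lge0 => r _; rewrite hornerM -expr2 sqr_ge0.
have oo : 0 <= L ((1 - 'X^2) * (o * o)).
  by apply: Lge0 => r r1; rewrite !hornerM -expr2 hX2 mulr_ge0 ?sqr_ge0 ?r2.
move: B1 B2 B3 kl ee oo.
set Ee := L (e * e); set Oo := L (_ * (o * o)); set D := L (_ * (_ * (_ * o))).
set E' := L (_ * (e^`() * _)); set X1 := L (_ * (e * o)); set X2 := L ((_ + _) * _).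
move=> /ler_normlP[D1 D2] /ler_normlP[X11 X12] /andP[X21 X22] kl ee oo.
have mk0 : m%:R = k - s by rewrite /k addrK.
have sX1 : s * X1 <= s * (2^-1 * (Ee + Oo)) by rewrite ler_pM2l.
have sX1' : s * - X1 <= s * (2^-1 * (Ee + Oo)) by rewrite ler_pM2l.
have sX2 : s / 2 * X2 <= s / 2 * (2 * (Ee + Oo)) by rewrite ler_pM2l// divr_gt0.
have sX2' : 0 <= s / 2 * X2 by rewrite mulr_ge0// divr_ge0// ltW.
have := s0 => ?; rewrite mk0 ler_norml.
have := mulr_ge0 (ltW s0) ee; have := mulr_ge0 (ltW s0) oo => *.
apply/andP; split; lra.
Qed.

End Pairs.

(** The indices are added in pairs, matching the induction on degree in [wiener_pair_span]. *)
Fixpoint sym_ints (m : nat) : seq int :=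
  if m is m'.+1 then [:: m%:Z, - m%:Z & sym_ints m'] else [:: 0].

Lemma mem_sym_ints m (k : int) : (k \in sym_ints m) = (`|k| <= m)%N.
Proof.
by elim: m k => [|m ih] k; rewrite /= !inE ?ih; lia.
Qed.

Lemma sym_ints_uniq m : uniq (sym_ints m).
Proof.
elim: m => //= m ->; rewrite !inE !mem_sym_ints; lia.
Qed.

Arguments sym_ints : simpl never.

(** * The Wiener functions as an orthonormal basis of pairs *)

Section WienerPairs.
Variables (R : realType) (s : R) (L : {scalar {poly R}}).
Implicit Types (F G : {poly R} * {poly R}) (k l : int).
Hypothesis s12 : 1 / 2 < s.
Hypothesis pL : pearson (- (1 / 2)) (s - 3 / 2) L.

Variables nu eta : nat -> R.
Hypothesis nuE : forall n,
  nu n ^+ 2 * L (jacobi (- (1 / 2)) (s - 3 / 2) n ^+ 2) = 2.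
Hypothesis etaE : forall n,
  eta n ^+ 2 * wshift L (jacobi (1 / 2) (s - 1 / 2) n ^+ 2) = 2.

(* [nu n] and [eta n] are the inverse Jacobi norms; the 2 in [nuE] and [etaE]
   appears because x in R covers r in [-1, 1] twice. *)
Definition wiener_pair (k : int) : {poly R} * {poly R} :=
  if k == 0 then
    (((Num.sqrt 2)^-1 * nu 0) *: jacobi (- (1 / 2)) (s - 3 / 2) 0, 0)
  else ((1 / 2 * nu `|k|%N) *: jacobi (- (1 / 2)) (s - 3 / 2) `|k|%N,
        (1 / 2 * (Num.sg k)%:~R * eta (`|k| - 1)%N) *:
          jacobi (1 / 2) (s - 1 / 2) (`|k| - 1)%N).

Let nu_neq0 n : nu n != 0.
Proof.
apply/eqP => e; have := nuE n; rewrite e expr0n mul0r => /esym/eqP.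
by rewrite pnatr_eq0.
Qed.

Let eta_neq0 n : eta n != 0.
Proof.
apply/eqP => e; have := etaE n; rewrite e expr0n mul0r => /esym/eqP.
by rewrite pnatr_eq0.
Qed.

Let qorth n m : n != m ->
  wshift L (jacobi (1 / 2) (s - 1 / 2) n * jacobi (1 / 2) (s - 1 / 2) m) = 0.
Proof.
apply: jacobi_orth.
have := pearson_shift pL.
have -> : - (1 / 2) + 1 = 1 / 2 :> R by field.
by have -> : s - 3 / 2 + 1 = s - 1 / 2 by field.
Qed.

(** For |k| = |l| > 0 the even parts contribute 1/2 and the odd parts sgn(k) sgn(l)/2, which add up
    to 1 or cancel. Otherwise Jacobi orthogonality kills both parts. *)
Lemma wiener_pair_orthonormal k l :
  pair_form L (wiener_pair k) (wiener_pair l) = (k == l)%:R.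
Proof.
have s2 : (Num.sqrt 2 : R) ^+ 2 = 2 by rewrite sqr_sqrtr.
have s2' : Num.sqrt 2 != 0 :> R by rewrite gt_eqF// sqrtr_gt0.
have half : 1 / 2 + 1 / 2 = 1 :> R by field.
rewrite /pair_form /wiener_pair.
have [k0|k0] := eqVneq k 0; have [l0|l0] := eqVneq l 0; rewrite ?k0 ?l0 /=.
- rewrite ?eqxx mul0r linear0 addr0 -scalerAl -scalerAr !scalarLZ.
  move: (nuE 0); rewrite expr2.
  move: (L _) => c e; apply: (mulfI (expf_neq0 2 s2')).
  rewrite [RHS]mulr1 [in RHS]s2 -[RHS]e; field.
  by [].
- rewrite mul0r linear0 addr0 -scalerAl -scalerAr !scalarLZ jacobi_orth//.
    by rewrite !mulr0 eq_sym (negbTE l0).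
  by rewrite eq_sym absz_eq0.
- rewrite mulr0 linear0 addr0 -scalerAl -scalerAr !scalarLZ jacobi_orth//.
    by rewrite !mulr0 (negbTE k0).
  by rewrite absz_eq0.
rewrite -!scalerAl -!scalerAr !scalarLZ /=.
have [kl|kl] := eqVneq `|k|%N `|l|%N; last first.
  rewrite jacobi_orth// qorth ?mulr0 ?addr0; last first.
    by apply: contra kl; lia.
  by have -> : (k == l) = false by apply/eqP => e; rewrite e eqxx in kl.
rewrite -kl.
have := nuE `|k|%N; have := etaE (`|k| - 1)%N; rewrite !expr2.
move: (nu _) (eta _) (L _) (wshift L _) => x y c d e1 e2.
have -> : (1 / 2 * x * (1 / 2 * x * c) : R) = 1 / 2.
  transitivity (1 / 2 * (1 / 2) * (x * x * c)); first by field.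
  by rewrite e2; field.
have -> : 1 / 2 * (Num.sg k)%:~R * y * (1 / 2 * (Num.sg l)%:~R * y * d) =
    1 / 2 * ((Num.sg k * Num.sg l)%:~R : R).
  rewrite intrM.
  transitivity (1 / 2 * (1 / 2) * (y * y * d) * ((Num.sg k)%:~R * (Num.sg l)%:~R)).
    by field.
  by rewrite e1; field.
have [kl'|kl'] := eqVneq k l.
  by rewrite kl' -expr2 sqr_sg l0 mulr1 half.
have -> : Num.sg k * Num.sg l = -1 by lia.
by rewrite mulrN1z mulrN1 subrr.
Qed.

Lemma wiener_pair_span F m : (size F.1 <= m.+1)%N -> (size F.2 <= m)%N ->
  exists c : int -> R, F = \sum_(k <- sym_ints m) c k *: wiener_pair k.
Proof.
have s2' : Num.sqrt 2 != 0 :> R by rewrite gt_eqF// sqrtr_gt0.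
have a0' : -1 < - (1 / 2) :> R by lra.
have b0' : -1 < s - 3 / 2 :> R by have := s12; lra.
have a1' : -1 < 1 / 2 :> R by lra.
have b1' : -1 < s - 1 / 2 :> R by have := s12; lra.
elim: m F => [|m ih] [e o] /= em om.
  exists (fun=> e`_0 * Num.sqrt 2 / nu 0).
  rewrite /sym_ints big_seq1 /wiener_pair eqxx jacobi0; congr pair.
    rewrite [LHS]size1_polyC//= scalerA alg_polyC; congr polyC.
    by field; rewrite s2' nu_neq0.
  by rewrite scaler0; apply/eqP; rewrite -size_poly_leq0.
pose P := jacobi (- (1 / 2)) (s - 3 / 2) m.+1; pose Q := jacobi (1 / 2) (s - 1 / 2) m.
(* [x] and [y] are the amounts of the top even and odd Jacobi terms. The indices m+1 and -(m+1)
   share the even part and have opposite odd parts, so the coefficients x+y and x-y produce both. *)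
pose x := e`_m.+1 / P`_m.+1 / nu m.+1; pose y := o`_m / Q`_m / eta m.
have Pn : P`_m.+1 != 0 by rewrite jacobi_coef_neq0.
have half : 1 / 2 + 1 / 2 = 1 :> R by field.
have Qn : Q`_m != 0 by rewrite jacobi_coef_neq0.
have step n (f g : {poly R}) (d : R) : (size f <= n.+1)%N -> (size g <= n.+1)%N ->
    f`_n = d * g`_n -> (size (f - d *: g)%R <= n)%N.
  move=> fn gn fg; apply/leq_sizeP => j nj; rewrite coefB coefZ.
  have [<-|jn] := eqVneq n j; first by rewrite fg subrr.
  have {jn nj} nj : (n < j)%N by rewrite ltn_neqAle jn.
  by rewrite !nth_default ?mulr0 ?subr0// (leq_trans _ nj).
have [||c ce] := ih (e - (x * nu m.+1) *: P, o - (y * eta m) *: Q).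
- apply: step => //; first exact: size_jacobi_le.
  by rewrite /x !divfK.
- apply: step => //; first exact: size_jacobi_le.
  by rewrite /y !divfK.
exists (fun k => if k == m.+1%:Z then x + y else if k == - m.+1%:Z then x - y else c k).
rewrite /sym_ints -/sym_ints !big_cons eqxx.
have -> : (- m.+1%:Z == m.+1%:Z) = false by lia.
rewrite eqxx [in RHS](eq_big_seq (fun k => c k *: wiener_pair k)); last first.
  move=> k; rewrite mem_sym_ints => km.
  have -> : (k == m.+1%:Z) = false by lia.
  by have -> : (k == - m.+1%:Z) = false by lia.
rewrite -ce /wiener_pair.
have -> : (m.+1%:Z == 0) = false by lia.
have -> : (- m.+1%:Z == 0) = false by lia.
rewrite abszN absz_nat subSS subn0 sgrN.
have -> : Num.sg m.+1%:Z = 1 by lia.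
rewrite -/P -/Q /=; congr pair => /=; rewrite addrA !scalerA -scalerDl.
  have -> : (x + y) * (1 / 2 * nu m.+1) + (x - y) * (1 / 2 * nu m.+1) = x * nu m.+1.
    by field.
  by rewrite addrC subrK.
have -> : (x + y) * (1 / 2 * 1%:~R * eta m) + (x - y) * (1 / 2 * (-1)%:~R * eta m) =
    y * eta m.
  by rewrite mulrN1z mulr1z; field.
by rewrite addrC subrK.
Qed.

End WienerPairs.

(** The six neighbours are exactly the indices whose absolute value differs from |k| by at most one,
    also for k = 0. In this form sparsity is a statement about degrees. *)
Lemma mem_nbrs (k l : int) : (l \in nbrs k) = (`|(`|l|%N)%:Z - (`|k|%N)%:Z| <= 1).
Proof.
rewrite mem_undup !inE /kvee /kwedge /sgn1.
by case: ifP => k0; lia.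
Qed.

(** * The banded symmetric matrix of the derivative *)

Section WienerMatrix.
Variables (R : realType) (s : R) (L : {scalar {poly R}}) (nu eta : nat -> R).
Implicit Types (F G : {poly R} * {poly R}) (k l : int).
Hypothesis s12 : 1 / 2 < s.
Hypothesis pL : pearson (- (1 / 2)) (s - 3 / 2) L.
Hypothesis nuE : forall n,
  nu n ^+ 2 * L (jacobi (- (1 / 2)) (s - 3 / 2) n ^+ 2) = 2.
Hypothesis etaE : forall n,
  eta n ^+ 2 * wshift L (jacobi (1 / 2) (s - 1 / 2) n ^+ 2) = 2.

Let phi := wiener_pair s nu eta.

Definition wiener_mat k l : R := pair_form L (pair_op s (phi k)) (phi l).

Lemma size_wiener_pair k :
  (size (phi k).1 <= `|k|.+1)%N && (size (phi k).2 <= `|k|)%N.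
Proof.
rewrite /phi /wiener_pair; have [->|k0] := eqVneq k 0 => /=.
  by rewrite size_poly0 (leq_trans (size_scale_leq _ _))// size_jacobi_le.
apply/andP; split; apply: (leq_trans (size_scale_leq _ _)).
  exact: size_jacobi_le.
by rewrite (leq_trans (size_jacobi_le _ _ _))//; lia.
Qed.

Lemma size_pair_op F m : (size F.1 <= m.+1)%N -> (size F.2 <= m)%N ->
  (size (pair_op s F).1 <= m.+2)%N && (size (pair_op s F).2 <= m.+1)%N.
Proof.
case: F => e o /= em om.
have hX : (size (1 + 'X : {poly R})%R <= 2)%N by rewrite addrC -polyC1 size_XaddC.
have hX1 : (size ('X : {poly R}) <= 2)%N by rewrite size_polyX.
have hX2 : (size (1 - 'X^2 : {poly R})%R <= 3)%N.
  by rewrite (leq_trans (size_polyD _ _))// size_polyN size_polyXn size_poly1.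
(* The implication leaves out [j = 0], where the product is zero. This occurs for [m = 0]: then
   [m.-1 = 0] and the size inequality itself fails for the product with the derivative of o. *)
have hM (f g : {poly R}) i j n : (size f <= i.+1)%N -> (size g <= j)%N ->
    ((0 < j)%N ==> (i + j <= n)%N) -> (size (f * g)%R <= n)%N.
  move=> fi gj ij; have [->|g0] := eqVneq g 0; first by rewrite mulr0 size_poly0.
  have g1 : (0 < size g)%N by rewrite size_poly_gt0.
  have j0 := leq_trans g1 gj; rewrite j0 /= in ij.
  by rewrite (leq_trans (size_polyMleq _ _))//; lia.
have hD (f g : {poly R}) n : (size f <= n)%N -> (size g <= n)%N -> (size (f + g)%R <= n)%N.
  by move=> fn gn; rewrite (leq_trans (size_polyD _ _))// geq_max fn.
have hZ c (f : {poly R}) n : (size f <= n)%N -> (size (c *: f)%R <= n)%N.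
  by move=> fn; rewrite (leq_trans (size_scale_leq _ _)).
have hN (f : {poly R}) n : (size f <= n)%N -> (size (- f)%R <= n)%N.
  by rewrite size_polyN.
have od : (size o^`() <= m.-1)%N.
  case: m om {em} => [|m] om; last by rewrite size_deriv_le.
  by move: om; rewrite leqn0 size_poly_eq0 => /eqP->; rewrite deriv0 size_poly0.
have ed : (size e^`() <= m)%N by rewrite size_deriv_le.
apply/andP; split; repeat (apply: (hD)); rewrite ?(leq_trans em)//.
- apply: (hM _ _ 1 m.+1) => //; last by lia.
  apply: hD; first by apply: (hM _ _ 1 m) => //; lia.
  by apply: hN; apply: (hM _ _ 2 m.-1) => //; lia.
- by apply/hN/hZ; apply: (hM _ _ 2 m) => //; lia.
- by apply/hN/hZ; apply: (hM _ _ 1 m.+1) => //; lia.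
- by apply: (hM _ _ 1 m) => //; lia.
- exact: hZ.
- by apply/hN/hZ; apply: (hM _ _ 1 m) => //; lia.
Qed.

Lemma wiener_pair_expand F m : (size F.1 <= m.+1)%N -> (size F.2 <= m)%N ->
  F = \sum_(k <- sym_ints m) pair_form L F (phi k) *: phi k.
Proof.
move=> F1 F2; have [c Fc] := wiener_pair_span s12 nuE etaE F1 F2.
rewrite [LHS]Fc; apply: eq_big_seq => k km; congr (_ *: _).
rewrite Fc pair_form_suml (bigD1_seq k km (sym_ints_uniq m))/= big1.
  by rewrite addr0 (wiener_pair_orthonormal s12 pL nuE etaE) eqxx mulr1.
move=> j jk.
by rewrite (wiener_pair_orthonormal s12 pL nuE etaE) (negbTE jk) mulr0.
Qed.

Lemma wiener_matC k l : wiener_mat k l = wiener_mat l k.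
Proof. by rewrite /wiener_mat (pair_op_sym pL) pair_formC. Qed.

Let wiener_mat0 k l : (`|k| + 1 < `|l|)%N -> wiener_mat k l = 0.
Proof.
move=> kl; have /andP[k1 k2] := size_wiener_pair k.
have /andP[A1 A2] := size_pair_op k1 k2.
rewrite /wiener_mat (wiener_pair_expand A1 A2) pair_form_suml big_seq big1// => j.
rewrite mem_sym_ints => jk; rewrite (wiener_pair_orthonormal s12 pL nuE etaE).
have -> : (j == l) = false by lia.
by rewrite mulr0.
Qed.

Lemma wiener_mat_sparse k l : l \notin nbrs k -> wiener_mat k l = 0.
Proof.
rewrite mem_nbrs => kl.
have [|] := ltnP (`|k| + 1) `|l|; first exact: wiener_mat0.
by move=> lk; rewrite wiener_matC wiener_mat0//; lia.
Qed.

Lemma pair_op_nbrs k :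
  pair_op s (phi k) = \sum_(l <- nbrs k) wiener_mat k l *: phi l.
Proof.
have /andP[k1 k2] := size_wiener_pair k.
have /andP[A1 A2] := size_pair_op k1 k2.
rewrite (wiener_pair_expand A1 A2) -/(wiener_mat k _).
rewrite (bigID (mem (nbrs k)))/= [X in _ + X]big1 ?addr0; last first.
  by move=> l /wiener_mat_sparse; rewrite /wiener_mat => ->; rewrite scale0r.
rewrite -big_filter; apply: perm_big; apply: uniq_perm.
- exact: filter_uniq (sym_ints_uniq _).
- exact: undup_uniq.
move=> l; rewrite mem_filter mem_sym_ints /= mem_nbrs.
by lia.
Qed.

Hypothesis L0 : 0 < L 1.
Hypothesis Lge0 : forall f : {poly R},
  (forall r, -1 <= r <= 1 -> 0 <= f.[r]) -> 0 <= L f.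

(** Truncation costs nothing: although A F may leave the span of the chosen functions, the form of
    the finite section is still <F, A F>, and the sum of squares is the norm of F since the indices
    are distinct. *)
Lemma wiener_mat_bound (n m : nat) (ix : 'I_n -> int) (x : 'I_n -> R) :
  injective ix -> (forall i, (`|ix i| <= m)%N) ->
  `|\sum_i \sum_j x i * x j * wiener_mat (ix i) (ix j)| <=
  (2 * m%:R + 7 / 2 * s) * \sum_i x i ^+ 2.
Proof.
move=> ixI ixm; pose F := \sum_i x i *: phi (ix i).
have F1 : (size F.1 <= m.+1)%N.
  rewrite /F raddf_sum/= (leq_trans (size_sum _ _ _))//; apply/bigmax_leqP => i _.
  rewrite (leq_trans (size_scale_leq _ _))//.
  by have /andP[h _] := size_wiener_pair (ix i); rewrite (leq_trans h)// ltnS.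
have -> : \sum_i x i ^+ 2 = pair_form L F F.
  rewrite [RHS]pair_form_suml; apply: eq_bigr => i _.
  rewrite pair_form_sumr (bigD1 i)//= big1.
    by rewrite addr0 (wiener_pair_orthonormal s12 pL nuE etaE) eqxx mulr1 expr2.
  move=> j ji; rewrite (wiener_pair_orthonormal s12 pL nuE etaE).
  by rewrite (inj_eq ixI) eq_sym (negbTE ji) mulr0.
have -> : \sum_i \sum_j x i * x j * wiener_mat (ix i) (ix j) = pair_form L F (pair_op s F).
  rewrite /F pair_op_sum [RHS]pair_form_suml; apply: eq_bigr => i _.
  rewrite pair_form_sumr mulr_sumr; apply: eq_bigr => j _.
  by rewrite wiener_matC /wiener_mat [pair_form _ _ (phi (ix i))]pair_formC mulrA.
exact: pair_op_bound.
Qed.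

End WienerMatrix.

(** * The weight functional *)

Import numFieldNormedType.Exports.
Local Open Scope classical_set_scope.
Local Open Scope ring_scope.

Lemma cvgr_powRN (R : realType) (T : Type) (F : set_system T) (FF : Filter F)
    (f : T -> R) (c : R) : 0 < c -> f @ F --> +oo ->
  (fun x => f x `^ (- c)) @ F --> (0 : R).
Proof.
move=> c0 /cvgryPgt foo; apply/cvgr0Pnorm_lt => e e0.
near=> x.
have fx : e `^ (- c^-1) < f x by near: x; apply: foo.
have e1 : 0 < e `^ (- c^-1) by exact: powR_gt0.
have f0 : 0 < f x by exact: lt_trans fx.
rewrite ger0_norm ?powR_ge0// powRN -[ltRHS]invrK ltf_pV2 ?posrE ?invr_gt0 ?powR_gt0//.
have -> : e^-1 = (e `^ (- c^-1)) `^ c.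
  by rewrite -powRrM mulNr mulVf ?gt_eqF// powRN powRr1// ltW.
by rewrite gt0_ltr_powR// nnegrE ltW.
Unshelve. all: by end_near. Qed.

Section Weight.
Variable R : realType.
Implicit Types (c x : R).
Notation mu := (@lebesgue_measure R).

Lemma oneDsqr_gt0 x : 0 < 1 + x ^+ 2.
Proof. by rewrite ltr_pwDl// sqr_ge0. Qed.

Lemma oneDsqr_neq0 x : 1 + x ^+ 2 != 0.
Proof. by rewrite gt_eqF// oneDsqr_gt0. Qed.

Lemma is_deriveMf (f g : R -> R) x a b :
  is_derive x 1 f a -> is_derive x 1 g b ->
  is_derive x 1 (fun y => f y * g y) (a * g x + f x * b).
Proof.
move=> fa gb; apply: (is_derive_eq (is_deriveM fa gb)).
by rewrite /GRing.scale/=; ring.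
Qed.

Lemma is_deriveDf (f g : R -> R) x a b :
  is_derive x 1 f a -> is_derive x 1 g b ->
  is_derive x 1 (fun y => f y + g y) (a + b).
Proof. by move=> fa gb; exact: is_deriveD. Qed.

Lemma is_deriveZf c (f : R -> R) x a :
  is_derive x 1 f a -> is_derive x 1 (fun y => c * f y) (c * a).
Proof. by move=> fa; exact: (is_deriveZ c fa). Qed.

Lemma is_derive_cstf c x : is_derive x 1 (fun _ : R => c) 0.
Proof. exact: is_derive_cst. Qed.

Lemma is_derive_idf x : is_derive x 1 (fun y : R => y) 1.
Proof. exact: is_derive_id. Qed.

Lemma is_derive_oneDsqr x : is_derive x 1 (fun y : R => 1 + y ^+ 2) (2 * x).
Proof.
apply: (is_derive_eq (is_deriveDf (is_derive_cstf 1 x)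
  (is_deriveMf (is_derive_idf x) (is_derive_idf x)))).
by ring.
Qed.

Lemma is_derive_powRf (g : R -> R) c x b : is_derive x 1 g b -> 0 < g x ->
  is_derive x 1 (fun y => g y `^ c) (c * g x `^ (c - 1) * b).
Proof.
move=> gb g0.
exact: (@is_derive1_comp R (fun y => y `^ c) g x _ _ (is_derive1_powR c g0) gb).
Qed.

Lemma is_derive_oneDsqr_powR c x :
  is_derive x 1 (fun y : R => (1 + y ^+ 2) `^ c)
    (2 * c * x / (1 + x ^+ 2) * (1 + x ^+ 2) `^ c).
Proof.
have h0 := oneDsqr_gt0 x.
have h := is_derive_powRf c (is_derive_oneDsqr x) h0.
apply: (is_derive_eq h).
rewrite powRB ?oneDsqr_neq0 ?implybT// powRr1 ?ltW//.
by field; rewrite oneDsqr_neq0.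
Qed.

Lemma continuous_oneDsqr_powR c : continuous (fun y : R => (1 + y ^+ 2) `^ c).
Proof.
move=> x; apply/differentiable_continuous/derivable1_diffP.
by have [] := is_derive_oneDsqr_powR c x.
Qed.

(** By evenness it is enough to treat x >= 0. There (1+x)^2 <= 2 (1+x^2) gives domination by 2^s
    (1+x)^(-2s), whose explicit antiderivative vanishes at infinity because 2s > 1. *)
Lemma integrable_oneDsqr_powR s : 1 / 2 < s ->
  mu.-integrable setT (EFin \o (fun x => (1 + x ^+ 2) `^ (- s))).
Proof.
move=> s12; apply/integrableP; split.
  apply/measurable_EFinP. apply: continuous_measurable_fun. exact: continuous_oneDsqr_powR.
under eq_integral do rewrite /= ger0_norm ?powR_ge0//.
rewrite ge0_symfun_integralT; last 3 first.
- by move=> x; exact: powR_ge0.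
- exact: continuous_oneDsqr_powR.
- by move=> x /=; rewrite sqrrN.
rewrite (_ : [set x | 0 <= x] = `[0, +oo[%classic :> set R); last first.
  by apply/seteqP; split => x /=; rewrite in_itv/= andbT.
pose F x : R := - (2 * s - 1)^-1 * (1 + x) `^ (- (2 * s - 1)).
pose f x : R := (1 + x) `^ (- (2 * s)).
have s1 : 0 < 2 * s - 1 by lra.
have dF x : 0 <= x -> is_derive x 1 F (f x).
  move=> x0; rewrite /F /f.
  have x1 : 0 < 1 + x by lra.
  have h := is_derive_powRf (- (2 * s - 1))
    (is_deriveDf (is_derive_cstf 1 x) (is_derive_idf x)) x1.
  apply: (is_derive_eq (is_deriveZf (- (2 * s - 1)^-1) h)).
  rewrite add0r mulr1 mulrA mulrNN mulVf ?gt_eqF// mul1r; congr (_ `^ _); ring.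
have cf x : 0 <= x -> {for x, continuous f}.
  move=> x0; rewrite /f.
  have x1 : 0 < 1 + x by lra.
  have h := is_derive_powRf (- (2 * s))
    (is_deriveDf (is_derive_cstf 1 x) (is_derive_idf x)) x1.
  by apply/differentiable_continuous/derivable1_diffP; case: h.
have FTC : (\int[mu]_(x in `[0%R, +oo[) (f x)%:E = 0%:E - (F 0)%:E)%E.
  apply: ge0_continuous_FTC2y.
  - by move=> x _; exact: powR_ge0.
  - apply: continuous_in_subspaceT => x; rewrite inE/= in_itv/= andbT.
    exact: cf.
  - rewrite -[X in _ --> X](mulr0 (- (2 * s - 1)^-1)).
    apply: cvgM; first exact: cvg_cst.
    apply: cvgr_powRN => //.
    by apply/cvgryPgt => A; near=> x; rewrite ltr_wpDl//; near: x; apply: nbhs_pinfty_gt; exact: num_real.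
  - by move=> x x0; have [] := dF x (ltW x0).
  - apply: cvg_at_right_filter; apply/differentiable_continuous/derivable1_diffP.
    by have [] := dF 0 (lexx _).
  - move=> x; rewrite in_itv/= andbT => x0; rewrite derive1E.
    by have [_] := dF x (ltW x0).
have le : (\int[mu]_(x in `[0%R, +oo[) ((1 + x ^+ 2) `^ (- s))%:E <=
    (2 `^ s)%:E * \int[mu]_(x in `[0%R, +oo[) (f x)%:E)%E.
  have mf D : measurable_fun D f.
    apply: (measurableT_comp (measurable_powR _)) => //.
    by apply: measurable_funD; [exact: measurable_cst|exact: measurable_id].
  rewrite -ge0_integralZl//=; last 2 first.
  - apply/measurable_EFinP; exact: mf.
  - by move=> x _; rewrite lee_fin powR_ge0.
  apply: ge0_le_integral => //=.
  - by move=> x _; rewrite lee_fin powR_ge0.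
  - apply/measurable_EFinP; apply: measurable_funTS; apply: continuous_measurable_fun.
    exact: continuous_oneDsqr_powR.
  - apply: measurable_funeM; apply/measurable_EFinP; exact: mf.
  move=> x; rewrite in_itv/= andbT => x0; rewrite -EFinM lee_fin /f.
  have x1 : 0 < 1 + x by lra.
  rewrite !powRN ler_pdivlMr ?powR_gt0// mulrC ler_pdivrMr ?powR_gt0 ?oneDsqr_gt0//.
  rewrite powRrM (powR_mulrn 2 (ltW x1)) -powRM ?(ltW (oneDsqr_gt0 _))//.
  rewrite ge0_ler_powR ?nnegrE ?sqr_ge0 ?mulr_ge0 ?(ltW (oneDsqr_gt0 _))//; first by lra.
  rewrite -subr_ge0 (_ : _ - _ = (1 - x) ^+ 2) ?sqr_ge0//; ring.
apply: (@le_lt_trans _ _ (2%:E * ((2 `^ s)%:E * \int[mu]_(x in `[0%R, +oo[) (f x)%:E))%E).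
  by rewrite lee_pmul2l.
by rewrite FTC -EFinB -!EFinM ltry.
Unshelve. all: by end_near. Qed.

End Weight.

(** * Integrals over the whole line *)

Section Improper.
Variable R : realType.
Implicit Types (h F f : R -> R) (x : R).
Notation mu := (@lebesgue_measure R).

Lemma cvg_Rintegral_sym h : mu.-integrable setT (EFin \o h) ->
  (fun n : nat => \int[mu]_(x in `[- n%:R, n%:R]) h x) @ \oo -->
  \int[mu]_x h x.
Proof.
move=> hi; have /integrableP[mh hoo] := hi.
pose D (n : nat) : set R := `[- n%:R, n%:R]%classic.
have [] := @dominated_convergence _ _ _ mu setT measurableT
  (fun n => (EFin \o h) \_ (D n)) (EFin \o h) (fun x => `|(h x)%:E|)%E.
- move=> n; apply/(measurable_restrictT _ _).1; first exact: measurable_itv.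
  exact: measurable_funTS.
- exact: mh.
- apply: aeW => x _; apply: cvg_near_cst; near=> n.
  rewrite patchE mem_set// /D/= in_itv/= -ler_norml.
  by near: n; exact: nbhs_infty_ger.
- exact: integrable_abse.
- apply: aeW => x n _; rewrite patchE; case: ifP => // _.
  by rewrite abse0 abse_ge0.
move=> _ _ cv.
have e n : \int[mu]_(x in D n) h x =
    fine (\int[mu]_x ((EFin \o h) \_ (D n)) x).
  by rewrite -integral_mkcond.
rewrite (_ : (fun n => _) = fine \o (fun n => \int[mu]_x ((EFin \o h) \_ (D n)) x)%E); last first.
  by apply/funext => n; rewrite /= -e.
apply: fine_cvg; rewrite /Rintegral fineK//.
exact: integrable_fin_num.
Unshelve. all: by end_near. Qed.

(** Oddness makes the integral over [-n, n] equal to 2 F(n), so the limit at +oo settles both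
    ends. *)
Lemma Rintegral_derive0 F f : (forall x, is_derive x 1 F (f x)) ->
  continuous f -> mu.-integrable setT (EFin \o f) ->
  F x @[x --> +oo] --> (0 : R) -> (forall x, F (- x) = - F x) ->
  \int[mu]_x f x = 0.
Proof.
move=> dF cf fi Foo Fodd.
have cv := cvg_Rintegral_sym fi.
apply: (cvg_unique _ cv) => //.
have cv' : (fun n : nat => 2 * F n%:R) @ \oo --> (0 : R).
  rewrite -[X in _ --> X](mulr0 2); apply: cvgM; first exact: cvg_cst.
  by apply: (cvg_comp _ _ _ Foo); exact: cvgr_idn.
apply: cvg_trans cv'; apply: near_eq_cvg; near=> n.
have n0 : 0 < n%:R :> R by rewrite ltr0n; near: n; exact: nbhs_infty_gt.
have cF : continuous F.
  by move=> x; apply/differentiable_continuous/derivable1_diffP; have [] := dF x.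
have nn : - n%:R < n%:R :> R by lra.
rewrite /Rintegral (@continuous_FTC2 _ f F)//.
- by rewrite -EFinB/= Fodd opprK mulr_natl mulr2n.
- exact: continuous_subspaceT.
- split.
  + by move=> x _; have [] := dF x.
  + by apply: cvg_at_right_filter; exact: cF.
  + by apply: cvg_at_left_filter; exact: cF.
- by move=> x _; rewrite derive1E; have [_] := dF x.
Unshelve. all: by end_near. Qed.

Lemma Rintegral_odd f : continuous f -> mu.-integrable setT (EFin \o f) ->
  (forall x, f (- x) = - f x) -> \int[mu]_x f x = 0.
Proof.
move=> cf fi fodd; have cv := cvg_Rintegral_sym fi.
apply: (cvg_unique _ cv) => //.
apply: cvg_near_cst; near=> n.
have n0 : 0 < n%:R :> R by rewrite ltr0n; near: n; exact: nbhs_infty_gt.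
have nn : - n%:R <= n%:R :> R by lra.
have nf : mu.-integrable `[- n%:R, n%:R] (EFin \o f).
  by apply: (integrableS measurableT _ _ fi) => //; exact: measurable_itv.
have e : \int[mu]_(x in `[- n%:R, n%:R]) f x = - \int[mu]_(x in `[- n%:R, n%:R]) f x.
  rewrite -[RHS]mulN1r -RintegralZl//.
  have h := @integration_by_substitution_oppr R f (- n%:R) n%:R nn.
  rewrite opprK in h.
  rewrite /Rintegral [in LHS]h; last exact: continuous_subspaceT.
  by congr fine; apply: eq_integral => x _ /=; rewrite fodd mulN1r.
by apply/eqP; rewrite -eqNr -e.
Unshelve. all: by end_near. Qed.

Lemma ge0_even_integral h : (forall x, 0 <= h x) -> continuous h ->
  (forall x, h (- x) = h x) ->
  (\int[mu]_x (h x)%:E = 2%:E * \int[mu]_(x in `]0%R, +oo[) (h x)%:E)%E.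
Proof.
move=> h0 ch hN; rewrite ge0_symfun_integralT//; last by move=> x /=; rewrite hN.
rewrite (_ : [set x | 0 <= x] = `[0, +oo[%classic :> set R); last first.
  by apply/seteqP; split => x /=; rewrite in_itv/= andbT.
rewrite integral_itv_obnd_cbnd//; apply/measurable_EFinP; apply: measurable_funTS.
exact: continuous_measurable_fun.
Qed.

End Improper.

(** * Integration against the weight on the line *)

Section WeightFunctional.
Variable R : realType.
Implicit Types (x s : R) (f g : {poly R}).
Notation mu := (@lebesgue_measure R).

(** Together with [cayley_im], the real and imaginary parts of the Cayley transform
    (1+ix)/(1-ix). *)
Definition cayley_re x : R := (1 - x ^+ 2) / (1 + x ^+ 2).
Definition cayley_im x : R := 2 * x / (1 + x ^+ 2).
Definition wiener_weight s x : R := 2 `^ s * (1 + x ^+ 2) `^ (- s).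

Lemma cayley_norm x : cayley_im x ^+ 2 = 1 - cayley_re x ^+ 2.
Proof. by rewrite /cayley_im /cayley_re; field; exact: oneDsqr_neq0. Qed.

Lemma oneD_cayley_re x : 1 + cayley_re x = 2 / (1 + x ^+ 2).
Proof. by rewrite /cayley_re; field; exact: oneDsqr_neq0. Qed.

Lemma cayley_re_itv x : -1 <= cayley_re x <= 1.
Proof.
rewrite -ler_norml -(@ler_pXn2r _ 2)// ?nnegrE//.
by rewrite expr1n real_normK ?num_real// -subr_ge0 -cayley_norm sqr_ge0.
Qed.

Lemma cayley_reN x : cayley_re (- x) = cayley_re x.
Proof. by rewrite /cayley_re sqrrN. Qed.

Lemma cayley_imN x : cayley_im (- x) = - cayley_im x.
Proof. by rewrite /cayley_im sqrrN mulrN mulNr. Qed.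

Lemma is_derive_oneDsqrV x :
  is_derive x 1 (fun y : R => (1 + y ^+ 2)^-1) (- (2 * x / (1 + x ^+ 2) ^+ 2)).
Proof.
have h0 := oneDsqr_neq0 x.
apply: (is_derive_eq (@is_deriveV R (fun y : R => 1 + y ^+ 2) x _ 1 h0 (is_derive_oneDsqr x))).
by rewrite /GRing.scale/=; field.
Qed.

(** Since dt/dx = 2/(1+x^2) = 1 + cos t, every derivative in x carries a factor 1+r; this is the
    source of the factors [1 + 'X] in [pair_op]. *)
Lemma is_derive_cayley_re x :
  is_derive x 1 cayley_re (- cayley_im x * (1 + cayley_re x)).
Proof.
have -> : cayley_re = (fun y => 2 * (1 + y ^+ 2)^-1 + -1).
  by apply/funext => y; rewrite /cayley_re; field; exact: oneDsqr_neq0.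
apply: (is_derive_eq (is_deriveDf (is_deriveZf 2 (is_derive_oneDsqrV x))
  (is_derive_cstf (-1) x))).
by rewrite /cayley_im; field; exact: oneDsqr_neq0.
Qed.

Lemma is_derive_cayley_im x :
  is_derive x 1 cayley_im (cayley_re x * (1 + cayley_re x)).
Proof.
apply: (is_derive_eq (is_deriveMf (is_deriveZf 2 (is_derive_idf x))
  (is_derive_oneDsqrV x))).
by rewrite /cayley_re; field; exact: oneDsqr_neq0.
Qed.

Lemma is_derive_horner_cayley f x :
  is_derive x 1 (fun y => f.[cayley_re y])
    (- cayley_im x * (1 + cayley_re x) * f^`().[cayley_re x]).
Proof.
apply: (is_derive_eq (@is_derive1_comp R (horner f) cayley_re x _ _
  (is_derive_poly f _) (is_derive_cayley_re x))).
by rewrite mulrC.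
Qed.

Lemma continuous_derive1 (h dh : R -> R) :
  (forall x : R, is_derive x 1 h (dh x)) -> continuous h.
Proof.
move=> dhE x; apply/differentiable_continuous/derivable1_diffP.
by have [] := dhE x.
Qed.

Lemma continuous_horner_cayley f : continuous (fun x => f.[cayley_re x]).
Proof. exact: continuous_derive1 (is_derive_horner_cayley f). Qed.

Lemma continuous_wiener_weight s : continuous (wiener_weight s).
Proof.
move=> x; apply: cvgM; first exact: cvg_cst.
exact: continuous_oneDsqr_powR.
Qed.

Lemma wiener_weight_ge0 s x : 0 <= wiener_weight s x.
Proof. by rewrite mulr_ge0 ?powR_ge0. Qed.

Lemma horner_bounded f : exists2 C : R, 0 <= C &
  forall r, -1 <= r <= 1 -> `|f.[r]| <= C.
Proof.
exists (\sum_(i < size f) `|f`_i|); first by apply: sumr_ge0.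
move=> r; rewrite -ler_norml => r1; rewrite horner_coef.
apply: (le_trans (ler_norm_sum _ _ _)); apply: ler_sum => i _.
by rewrite normrM ler_piMr// normrX exprn_ile1.
Qed.

Lemma integrable_wiener_weight s (h : R -> R) (C : R) : 1 / 2 < s ->
  continuous h -> (forall x, `|h x| <= C) ->
  mu.-integrable setT (EFin \o (fun x => h x * wiener_weight s x)).
Proof.
move=> s12 ch hC.
have C0 : 0 <= C := le_trans (normr_ge0 _) (hC 0).
have wi := integrable_oneDsqr_powR s12.
apply: (le_integrable _ _ _ (integrableZl measurableT (C * 2 `^ s) wi)) => //.
- apply/measurable_EFinP; apply: continuous_measurable_fun => x.
  by apply: cvgM; [exact: ch|exact: continuous_wiener_weight].
- move=> x _ /=; rewrite lee_fin normrM [`|wiener_weight _ _|]ger0_norm ?wiener_weight_ge0//.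
  rewrite [leRHS]ger0_norm ?mulr_ge0 ?powR_ge0// /wiener_weight [leLHS]mulrA.
  by rewrite ler_wpM2r ?powR_ge0// ler_wpM2r ?powR_ge0.
Qed.

Lemma integrable_horner_weight s f : 1 / 2 < s ->
  mu.-integrable setT (EFin \o (fun x => f.[cayley_re x] * wiener_weight s x)).
Proof.
move=> s12; have [C C0 fC] := horner_bounded f.
apply: (integrable_wiener_weight s12 (@continuous_horner_cayley f) (C := C)).
by move=> x; exact/fC/cayley_re_itv.
Qed.

(** The proof [hs] is an argument because linearity rests on integrability; the linear structure can
    then be attached to the function itself. *)
Definition weight_functional s (hs : 1 / 2 < s) f : R :=
  \int[mu]_x (f.[cayley_re x] * wiener_weight s x).

Fact weight_functional_is_scalar s (hs : 1 / 2 < s) :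
  scalar (weight_functional hs).
Proof.
move=> c f g; rewrite /weight_functional -RintegralZl//; last first.
  exact: integrable_horner_weight.
rewrite -RintegralD//; last 2 first.
- rewrite (_ : EFin \o _ =
      (EFin \o (fun x => (c *: f).[cayley_re x] * wiener_weight s x))).
    exact: integrable_horner_weight.
  by apply/funext => x /=; rewrite hornerZ mulrA.
- exact: integrable_horner_weight.
by apply: eq_Rintegral => x _; rewrite hornerD hornerZ mulrDl -mulrA.
Qed.

HB.instance Definition _ s (hs : 1 / 2 < s) :=
  GRing.isLinear.Build R {poly R} R *%R (weight_functional hs)
    (weight_functional_is_scalar hs).

Lemma weight_functional_ge0 s (hs : 1 / 2 < s) f :
  (forall r, -1 <= r <= 1 -> 0 <= f.[r]) -> 0 <= weight_functional hs f.
Proof.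
move=> f0; apply: Rintegral_ge0 => x _.
by rewrite mulr_ge0 ?wiener_weight_ge0 ?f0 ?cayley_re_itv.
Qed.

(** The weight is (2/(1+x^2))^s, which is at least 1 on [0, 1]. *)
Lemma weight_functional1_gt0 s (hs : 1 / 2 < s) : 0 < weight_functional hs 1.
Proof.
have wi : mu.-integrable setT (EFin \o wiener_weight s).
  have := integrable_horner_weight 1 hs.
  by congr (_.-integrable _ (_ \o _)); apply/funext => x; rewrite hornerC mul1r.
rewrite /weight_functional (_ : (fun x => _) = wiener_weight s); last first.
  by apply/funext => x; rewrite hornerC mul1r.
rewrite -lte_fin /Rintegral fineK; last exact: integrable_fin_num.
have m01 : measurable (`[0, 1]%classic : set R) by exact: measurable_itv.
have h1 : (\int[mu]_(x in `[0%R, 1%R]) (wiener_weight s x)%:E <=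
    \int[mu]_x (wiener_weight s x)%:E)%E.
  apply: ge0_subset_integral => //.
  - by have /integrableP[] := wi.
  - by move=> x _; rewrite lee_fin wiener_weight_ge0.
have h2 : (\int[mu]_(x in `[0%R, 1%R]) (1%:E) = 1%:E)%E.
  rewrite integral_cst//= lebesgue_measure_itv/= lte_fin ltr01 -EFinB subr0.
  by rewrite mul1e.
apply: (lt_le_trans _ h1); apply: (@lt_le_trans _ _ 1%:E); first by rewrite lte_fin.
rewrite -[leLHS]h2; apply: ge0_le_integral => //.
- by apply: measurable_funTS; have /integrableP[] := wi.
- move=> x; rewrite /= in_itv/= => /andP[x0 x1]; rewrite lee_fin.
  rewrite /wiener_weight powRN ler_pdivlMr ?powR_gt0 ?oneDsqr_gt0// mul1r.
  rewrite ge0_ler_powR ?nnegrE ?(ltW (oneDsqr_gt0 _))//; first by lra.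
  by nra.
Qed.

(** As sin t decays like 2/x, the product is of order x^(1-2s). The proof bounds it by a multiple of
    (1+x^2)^(1/2-s). *)
Lemma cvg_cayley_powR s f : 1 / 2 < s ->
  cayley_im x * f.[cayley_re x] * (1 + x ^+ 2) `^ (1 - s) @[x --> +oo]
    --> (0 : R).
Proof.
move=> hs; have [C C0 fC] := horner_bounded f.
have lim0 : (2 * C) * (1 + x ^+ 2) `^ (- (s - 1 / 2)) @[x --> +oo] --> (0 : R).
  rewrite -[X in _ --> X](mulr0 (2 * C)); apply: cvgM; first exact: cvg_cst.
  apply: cvgr_powRN; first by lra.
  apply/cvgryPgt => A; near=> x.
  have x1 : 1 < x by near: x; apply: nbhs_pinfty_gt; exact: num_real.
  have xA : A < x by near: x; apply: nbhs_pinfty_gt; exact: num_real.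
  nra.
apply/norm_cvg0P.
apply: (squeeze_cvgr _ (cvg_cst 0) lim0); near=> x.
have x0 : 0 < x by near: x; apply: nbhs_pinfty_gt; exact: num_real.
have h0 := oneDsqr_gt0 x.
have Q0 := powR_ge0 (1 + x ^+ 2) (- s).
have e1 : (1 + x ^+ 2) `^ (1 - s) = (1 + x ^+ 2) * (1 + x ^+ 2) `^ (- s).
  by rewrite powRD ?powRr1 ?ltW// oneDsqr_neq0 implybT.
have e2 : (1 + x ^+ 2) `^ (- (s - 1 / 2)) =
    Num.sqrt (1 + x ^+ 2) * (1 + x ^+ 2) `^ (- s).
  rewrite opprB powRD ?oneDsqr_neq0 ?implybT//.
  by rewrite div1r powR12_sqrt// ltW.
have xs : x <= Num.sqrt (1 + x ^+ 2).
  by rewrite -[leLHS]gtr0_norm// -sqrtr_sqr ler_wsqrtr// lerDr.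
have ci : `|cayley_im x| = 2 * x / (1 + x ^+ 2).
  by rewrite ger0_norm// /cayley_im divr_ge0 ?mulr_ge0// ltW.
have ineq (a q : R) : 0 <= a -> a <= C -> 0 <= q ->
    2 * x / (1 + x ^+ 2) * a * ((1 + x ^+ 2) * q) <=
    2 * C * (Num.sqrt (1 + x ^+ 2) * q).
  move=> a0 aC q0.
  have -> : 2 * x / (1 + x ^+ 2) * a * ((1 + x ^+ 2) * q) = 2 * (x * a * q).
    by field; exact: oneDsqr_neq0.
  rewrite -[leRHS]mulrA ler_wpM2l// -mulrA [leRHS]mulrCA.
  apply: ler_pM => //; [exact: mulr_ge0|exact: ler_wpM2r].
rewrite normr_ge0/= e1 e2 normrM [`|cayley_im x * _|]normrM ci.
rewrite [`|(1 + _) * _|]ger0_norm ?mulr_ge0 ?(ltW h0)//.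
apply: ineq => //; exact/fC/cayley_re_itv.
Unshelve. all: by end_near. Qed.

Lemma weight_functional_pearson s (hs : 1 / 2 < s) :
  pearson (- (1 / 2)) (s - 3 / 2) (weight_functional hs).
Proof.
move=> g.
set f := (1 - 'X^2) * _ + _ * g; rewrite -[LHS]/(weight_functional hs f).
(* This is minus (1-r)^(1/2) (1+r)^(s-1/2) g, written for x > 0 as sin t (1+r)^(s-1) g and then
   extended to an odd function of x. The sign appears because r decreases in x there. *)
pose F x := - 2 `^ s / 2 * (cayley_im x * g.[cayley_re x] * (1 + x ^+ 2) `^ (1 - s)).
apply: (@Rintegral_derive0 R F (fun x => f.[cayley_re x] * wiener_weight s x)).
- move=> x.
  apply: (is_derive_eq (is_deriveZf _ (is_deriveMf (is_deriveMf
    (is_derive_cayley_im x) (is_derive_horner_cayley g x))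
    (is_derive_oneDsqr_powR (1 - s) x)))).
  have -> : (1 + x ^+ 2) `^ (1 - s) = (1 + x ^+ 2) * (1 + x ^+ 2) `^ (- s).
    by rewrite powRD ?powRr1 ?(ltW (oneDsqr_gt0 x))// oneDsqr_neq0 implybT.
  have -> : f.[cayley_re x] = (1 - cayley_re x ^+ 2) * g^`().[cayley_re x] +
      ((s - 3 / 2 + 1) * (1 - cayley_re x) -
       (- (1 / 2) + 1) * (1 + cayley_re x)) * g.[cayley_re x].
    rewrite /f !(hornerD, hornerN, hornerM, hornerZ, hornerXn, hornerX).
    by rewrite -polyC1 hornerC.
  rewrite /wiener_weight; move: (2 `^ s) (_ `^ _) (g.[_]) (g^`().[_]) => a b c d.
  by rewrite /cayley_im /cayley_re; field; exact: oneDsqr_neq0.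
- move=> x; apply: cvgM; first exact: continuous_horner_cayley.
  exact: continuous_wiener_weight.
- exact: integrable_horner_weight.
- rewrite -[X in _ --> X](mulr0 (- 2 `^ s / 2)); apply: cvgM; first exact: cvg_cst.
  exact: cvg_cayley_powR.
- by move=> x; rewrite /F cayley_imN cayley_reN sqrrN !mulNr mulrN.
Qed.

End WeightFunctional.

(** * Change of variable from the line to [-1, 1] *)

Section Substitution.
Variable R : realType.
Implicit Types (x s r : R) (f : {poly R}).
Notation mu := (@lebesgue_measure R).

Lemma oneB_cayley_re x : 1 - cayley_re x = x ^+ 2 * (1 + cayley_re x).
Proof. by rewrite /cayley_re; field; exact: oneDsqr_neq0. Qed.

Lemma oneD_cayley_re_gt0 x : 0 < 1 + cayley_re x.
Proof. by rewrite oneD_cayley_re divr_gt0// oneDsqr_gt0. Qed.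

Lemma cayley_re_lt1 x : 0 < x -> cayley_re x < 1.
Proof.
by move=> x0; rewrite -subr_gt0 oneB_cayley_re mulr_gt0 ?exprn_gt0// oneD_cayley_re_gt0.
Qed.

Lemma cayley_re_decr x y : 0 <= x -> x < y -> cayley_re y < cayley_re x.
Proof.
move=> x0 xy; rewrite -(ltrD2l 1) !oneD_cayley_re ltr_pM2l// ltf_pV2 ?posrE ?oneDsqr_gt0//.
by rewrite ltrD2l ltr_pXn2r// ?nnegrE// (le_trans x0)// ltW.
Qed.

Definition jacobi_weight s r : R := (1 - r) `^ (- (1 / 2)) * (1 + r) `^ (s - 3 / 2).

(** With T = 1+r one has 1-r = x^2 T, sin t = x T and the weight on the line is T^s; the powers of x
    cancel. *)
Lemma jacobi_weight_cayley s x : 0 < x ->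
  jacobi_weight s (cayley_re x) * (cayley_im x * (1 + cayley_re x)) =
  wiener_weight s x.
Proof.
move=> x0; have T0 := oneD_cayley_re_gt0 x.
rewrite /jacobi_weight oneB_cayley_re.
have -> : cayley_im x = x * (1 + cayley_re x).
  by rewrite oneD_cayley_re /cayley_im; field; exact: oneDsqr_neq0.
have -> : wiener_weight s x = (1 + cayley_re x) `^ s.
  rewrite oneD_cayley_re powRM// ?invr_ge0 ?(ltW (oneDsqr_gt0 x))//.
  by rewrite -[(1 + _)^-1]powR_inv1 ?(ltW (oneDsqr_gt0 x))// -powRrM mulN1r.
rewrite powRM ?exprn_ge0 ?ltW//.
have -> : (x ^+ 2) `^ (- (1 / 2)) = x^-1.
  rewrite -powR_mulrn ?ltW// -powRrM (_ : 2%:R * _ = -1) ?powR_inv1 ?ltW//.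
  by field.
move: (1 + _) T0 => T T0.
transitivity (T `^ (- (1 / 2)) * T `^ (s - 3 / 2) * T ^+ 2).
  by field; rewrite gt_eqF.
rewrite -powR_mulrn ?ltW// -!powRD ?(gt_eqF T0) ?implybT//.
by congr (_ `^ _); field.
Qed.

Lemma continuous_jacobi_weight s r : -1 < r < 1 ->
  {for r, continuous (jacobi_weight s)}.
Proof.
move=> /andP[r0 r1].
have h1 : 0 < 1 - r by lra.
have h2 : 0 < 1 + r by lra.
have d1 := is_derive_powRf (- (1 / 2)) (is_deriveDf (is_derive_cstf 1 r)
  (is_deriveNid r (1 : R))) h1.
have d2 := is_derive_powRf (s - 3 / 2) (is_deriveDf (is_derive_cstf 1 r)
  (is_derive_idf r)) h2.
have d3 := is_deriveMf d1 d2.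
by apply/differentiable_continuous/derivable1_diffP; have [] := d3.
Qed.

Lemma jacobi_weight_ge0 s r : 0 <= jacobi_weight s r.
Proof. by rewrite mulr_ge0 ?powR_ge0. Qed.

Lemma measurable_jacobi_weight s f :
  measurable_fun setT (fun r => f.[r] * jacobi_weight s r).
Proof.
apply: measurable_funM; first by apply: continuous_measurable_fun; exact: continuous_horner.
apply: measurable_funM.
  apply: (measurableT_comp (measurable_powR _)) => //.
  by apply: measurable_funB.
apply: (measurableT_comp (measurable_powR _)) => //.
by apply: measurable_funD.
Qed.

Lemma jacobi_substitution s f (a b : R) : 0 < a -> a < b ->
  (\int[mu]_(r in `[cayley_re b, cayley_re a]) (f.[r] * jacobi_weight s r)%:E =
   \int[mu]_(x in `[a, b]) (f.[cayley_re x] * wiener_weight s x)%:E)%E.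
Proof.
move=> a0 ab.
have dF : derive1 (@cayley_re R) = (fun x => - cayley_im x * (1 + cayley_re x)).
  by apply/funext => x; rewrite derive1E; have [_] := is_derive_cayley_re x.
have cre : continuous (@cayley_re R).
  exact: continuous_derive1 (@is_derive_cayley_re R).
have cim : continuous (@cayley_im R).
  exact: continuous_derive1 (@is_derive_cayley_im R).
have cF : continuous (fun x => - cayley_im x * (1 + cayley_re x)).
  move=> x; apply: cvgM; first by apply: cvgN; exact: cim.
  by apply: cvgD; [exact: cvg_cst|exact: cre].
rewrite (@integration_by_substitution_decreasing R (@cayley_re R)
  (fun r => f.[r] * jacobi_weight s r)) ?ltW//.
- apply: eq_integral => x; rewrite inE/= in_itv/= => /andP[ax _].
  have x0 : 0 < x by exact: lt_le_trans ax.
  rewrite -(jacobi_weight_cayley s x0) /= dF.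
  congr (_%:E).
  rewrite -[LHS]/(f.[cayley_re x] * jacobi_weight s (cayley_re x) *
    - (- cayley_im x * (1 + cayley_re x))).
  by ring.
- move=> x y; rewrite !in_itv/= => _ /andP[ay _] yx.
  exact: (cayley_re_decr (le_trans (ltW a0) ay)).
- by move=> x _; rewrite dF; exact: cF.
- by rewrite dF; apply/cvg_ex; eexists; apply: cvg_at_right_filter; exact: cF.
- by rewrite dF; apply/cvg_ex; eexists; apply: cvg_at_left_filter; exact: cF.
- split.
  + by move=> x _; have [] := is_derive_cayley_re x.
  + by apply: cvg_at_right_filter; exact: cre.
  + by apply: cvg_at_left_filter; exact: cre.
- apply: continuous_in_subspaceT => r; rewrite inE/= in_itv/= => /andP[r0 r1].
  apply: cvgM; first exact: continuous_horner.
  apply: continuous_jacobi_weight; apply/andP; split.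
    by apply: lt_le_trans r0; have := oneD_cayley_re_gt0 b; lra.
  by apply: le_lt_trans r1 _; exact: cayley_re_lt1.
Qed.

(** Compact intervals, whose images avoid the singular endpoints, exhaust (0, +oo) and (-1, 1).
    Nonnegativity of f allows passing to the limit by monotone convergence, and evenness in x gives
    the factor 1/2. *)
Lemma weight_functional_jacobi s (hs : 1 / 2 < s) f :
  (forall r, -1 <= r <= 1 -> 0 <= f.[r]) ->
  \int[mu]_(r in `[-1, 1]) (f.[r] * jacobi_weight s r) =
  weight_functional hs f / 2.
Proof.
move=> f0.
pose h x := f.[cayley_re x] * wiener_weight s x.
have hi : mu.-integrable setT (EFin \o h) := integrable_horner_weight f hs.
have hi0 : mu.-integrable `]0, +oo[ (EFin \o h).
  by apply: (integrableS measurableT _ _ hi).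
have Jfin : (\int[mu]_(x in `]0%R, +oo[) (h x)%:E)%E \is a fin_num.
  by apply: (integrable_fin_num _ hi0).
have h0 x : 0 <= h x by rewrite mulr_ge0 ?wiener_weight_ge0 ?f0 ?cayley_re_itv.
have ch : continuous h.
  move=> x; apply: cvgM; first exact: continuous_horner_cayley.
  exact: continuous_wiener_weight.
have e2 : (\int[mu]_x (h x)%:E = 2%:E * \int[mu]_(x in `]0%R, +oo[) (h x)%:E)%E.
  apply: ge0_even_integral => // x.
  by rewrite /h cayley_reN /wiener_weight sqrrN.
pose G r := f.[r] * jacobi_weight s r.
pose a (n : nat) : R := n.+1%:R^-1.
(* The shift by two gives [a n < b n] already for [n = 0], where [a 0 = 1]. *)
pose b (n : nat) : R := n.+2%:R.
have a0 n : 0 < a n by rewrite invr_gt0.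
have ab n : a n < b n.
  rewrite /a /b (@le_lt_trans _ _ 1)// ?ltr1n// invf_le1// ler1n.
  by [].
have adecr n m : (n <= m)%N -> a m <= a n.
  by move=> nm; rewrite lef_pV2 ?posrE// ler_nat.
have bincr n m : (n <= m)%N -> b n <= b m by move=> nm; rewrite ler_nat.
have cre_le x y : 0 <= x -> x <= y -> cayley_re y <= cayley_re x.
  move=> x0; rewrite le_eqVlt => /predU1P[->//|xy].
  exact/ltW/cayley_re_decr.
pose D n : set R := `[a n, b n]%classic.
pose E n : set R := `[cayley_re (b n), cayley_re (a n)]%classic.
have UD : \bigcup_n D n = `]0, +oo[%classic.
  apply/seteqP; split=> x /=.
    by move=> [n _]; rewrite /D/= !in_itv/= andbT => /andP[+ _]; exact: lt_le_trans.
  rewrite in_itv/= andbT => x0.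
  have [n nx] : exists n : nat, Num.max x x^-1 < n%:R.
    exists (Num.bound (Num.max x x^-1)).
    by apply: archi_boundP; rewrite le_max (ltW x0).
  move: nx; rewrite gt_max => /andP[nx nxV].
  exists n => //; rewrite /D/= in_itv/= /a /b; apply/andP; split.
    rewrite -[leRHS]invrK lef_pV2 ?posrE ?invr_gt0//.
    by rewrite (le_trans (ltW nxV))// ler_nat.
  by rewrite (le_trans (ltW nx))// ler_nat -addn2 leq_addr.
have UE : \bigcup_n E n = `]-1, 1[%classic.
  apply/seteqP; split=> r /=.
    move=> [n _]; rewrite /E/= !in_itv/= => /andP[r0 r1]; apply/andP; split.
      by apply: lt_le_trans r0; have := oneD_cayley_re_gt0 (b n); lra.
    by apply: le_lt_trans r1 _; exact: cayley_re_lt1.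
  rewrite in_itv/= => /andP[r0 r1].
  pose x := Num.sqrt ((1 - r) / (1 + r)).
  have q0 : 0 < (1 - r) / (1 + r) by apply: divr_gt0; lra.
  have x0 : 0 < x by rewrite sqrtr_gt0.
  have xr : cayley_re x = r.
    rewrite /cayley_re /x sqr_sqrtr ?ltW//; field.
    by apply/andP; split; apply/eqP => e; lra.
  have : (\bigcup_n D n) x by rewrite UD/= in_itv/= x0.
  move=> [n _]; rewrite /D/= in_itv/= => /andP[ax xb].
  exists n => //; rewrite /E/= in_itv/= -xr !cre_le// ltW//.
have cD : (\int[mu]_(x in D n) (h x)%:E)%E @[n --> \oo] -->
    (\int[mu]_(x in `]0%R, +oo[) (h x)%:E)%E.
  rewrite -UD; apply: ge0_nondecreasing_set_cvg_integral => //.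
  - move=> n m nm; rewrite /D subsetEset => x /=; rewrite !in_itv/= => /andP[ax xb].
    by rewrite (le_trans (adecr _ _ nm))// (le_trans xb)// bincr.
  - by move=> n; exact: measurable_itv.
  - by move=> n; apply/measurable_EFinP; apply: measurable_funTS; apply: continuous_measurable_fun.
  - by move=> n x _; rewrite lee_fin.
have cE : (\int[mu]_(x in E n) (G x)%:E)%E @[n --> \oo] -->
    (\int[mu]_(x in `](-1)%R, 1%R[) (G x)%:E)%E.
  rewrite -UE; apply: ge0_nondecreasing_set_cvg_integral => //.
  - move=> n m nm; rewrite /E subsetEset => r /=; rewrite !in_itv/= => /andP[r0 r1].
    rewrite (le_trans _ r0) ?(le_trans r1)// cre_le ?adecr ?bincr//; exact: ltW.
  - by move=> n; exact: measurable_itv.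
  - by move=> n; apply/measurable_EFinP; apply: measurable_funTS; exact: measurable_jacobi_weight.
  - move=> n r; rewrite /E/= in_itv/= => /andP[r0 r1]; rewrite lee_fin.
    rewrite mulr_ge0 ?jacobi_weight_ge0// f0//.
    have /andP[? _] := cayley_re_itv (b n).
    have /andP[_ ?] := cayley_re_itv (a n).
    by apply/andP; split; lra.
have e : (\int[mu]_(x in `](-1)%R, 1%R[) (G x)%:E = \int[mu]_(x in `]0%R, +oo[) (h x)%:E)%E.
  have ED : (fun n => \int[mu]_(x in E n) (G x)%:E)%E =
      (fun n => \int[mu]_(x in D n) (h x)%:E)%E.
    by apply/funext => n; exact: jacobi_substitution.
  by rewrite ED in cE; exact: cvg_unique cE cD.
have e3 : weight_functional hs f = 2 * fine (\int[mu]_(x in `]0%R, +oo[) (h x)%:E)%E.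
  by rewrite -[LHS]/(fine (\int[mu]_x (h x)%:E)%E) e2 fineM.
have e4 : (\int[mu]_(r in `[(-1)%R, 1%R]) (G r)%:E =
    \int[mu]_(r in `](-1)%R, 1%R[) (G r)%:E)%E.
  apply: integral_itv_bndoo; apply/measurable_EFinP; apply: measurable_funTS.
  exact: measurable_jacobi_weight.
have -> : weight_functional hs f / 2 =
    fine (\int[mu]_(x in `]0%R, +oo[) (h x)%:E)%E.
  by rewrite e3 mulrAC divff ?pnatr_eq0 ?mul1r.
by rewrite -e -e4.
Qed.

End Substitution.

(** * Wiener rational functions *)

Local Open Scope complex_scope.

Local Open Scope complex_scope.

Section PairFunctions.
Variable R : realType.
Implicit Types (x s : R) (F G : {poly R} * {poly R}).
Notation mu := (@lebesgue_measure R).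

Lemma jacobi_normE s (hs : 1 / 2 < s) n :
  jacobi_norm (- (1 / 2)) (s - 3 / 2) n =
  Num.sqrt (weight_functional hs (jacobi (- (1 / 2)) (s - 3 / 2) n ^+ 2) / 2).
Proof.
rewrite /jacobi_norm -weight_functional_jacobi; last first.
  by move=> r _; rewrite horner_exp sqr_ge0.
by congr Num.sqrt; apply: eq_Rintegral => r _; rewrite horner_exp.
Qed.

Lemma jacobi_norm_shiftE s (hs : 1 / 2 < s) n :
  jacobi_norm (1 / 2) (s - 1 / 2) n =
  Num.sqrt (wshift (weight_functional hs) (jacobi (1 / 2) (s - 1 / 2) n ^+ 2) / 2).
Proof.
rewrite /jacobi_norm /wshift/= -weight_functional_jacobi; last first.
  move=> r /andP[r0 r1]; rewrite hornerM horner_exp mulr_ge0 ?sqr_ge0//.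
  by rewrite !hornerE; nra.
congr Num.sqrt; apply: eq_Rintegral => r.
rewrite inE/= in_itv/= hornerM horner_exp => /andP[r0 r1].
rewrite (_ : (1 - 'X^2).[r] = (1 - r) * (1 + r)); last by rewrite !hornerE; ring.
(* Also valid at [y = 0], where both sides vanish, so the endpoints r = 1 and r = -1 are covered. *)
have h (y c : R) : 0 <= y -> 0 < c + 1 -> y `^ (c + 1) = y * y `^ c.
  rewrite le_eqVlt => /predU1P[<-|y0] c0.
    by rewrite mul0r powR0// gt_eqF.
  by rewrite powRD ?gt_eqF ?implybT// powRr1 ?ltW// mulrC.
have hA : (1 - r) `^ (1 / 2) = (1 - r) * (1 - r) `^ (- (1 / 2)).
  by rewrite -h; [congr (_ `^ _); field|lra|lra].
have hB : (1 + r) `^ (s - 1 / 2) = (1 + r) * (1 + r) `^ (s - 3 / 2).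
  by rewrite -h; [congr (_ `^ _); field|lra|lra].
by rewrite /jacobi_weight hA hB; ring.
Qed.

Definition wiener_phase s x : R[i] := (2 `^ (s / 2))%:C * xmi_powN s x.

Definition pair_fun s F x : R[i] :=
  wiener_phase s x * (F.1.[cayley_re x] +i* (cayley_im x * F.2.[cayley_re x])).

Lemma wiener_phiE s k x : wiener_phi s k x =
  pair_fun s (wiener_pair s
    (fun n => (jacobi_norm (- (1 / 2)) (s - 3 / 2) n)^-1)
    (fun n => (jacobi_norm (1 / 2) (s - 1 / 2) n)^-1) k) x.
Proof.
rewrite /wiener_phi /pair_fun -/(wiener_phase s x); congr (_ * _).
rewrite /wiener_Phi /wiener_pair -/(cayley_re x) /njacobi; case: ifP => k0 /=.
  by rewrite horner0 mulr0 hornerZ; apply/eqP; rewrite eq_complex/= eqxx andbT; apply/eqP; ring.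
rewrite !hornerZ /cayley_im.
move: (jacobi _ _ _).[_] (jacobi _ _ _).[_] (jacobi_norm _ _ _) (jacobi_norm _ _ _).
move=> p q u v; apply/eqP; rewrite eq_complex/=.
by apply/andP; split; apply/eqP; rewrite ?[x ^+ 2 + 1]addrC; ring.
Qed.

Lemma pair_fun_sum (I : Type) (r : seq I) (c : I -> R)
    (Fs : I -> {poly R} * {poly R}) s x :
  pair_fun s (\sum_(i <- r) c i *: Fs i) x =
  \sum_(i <- r) (c i)%:C * pair_fun s (Fs i) x.
Proof.
elim: r => [|i r ih].
  by rewrite !big_nil /pair_fun/= !horner0 mulr0 mulr0.
rewrite !big_cons -ih /pair_fun/= !hornerD !hornerZ.
rewrite mulrCA -mulrDr; congr (_ * _); apply/eqP; rewrite eq_complex/=.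
by apply/andP; split; apply/eqP; ring.
Qed.

(** These are the components of w' = -s w/(x-i), where 1/(x-i) = (x+i)/(1+x^2) = (sin t + i (1 + cos
    t))/2. *)
Lemma is_derive_wiener_phase s x :
  is_derive x 1 (fun y => complex.Re (wiener_phase s y))
    (- (s / 2) * (cayley_im x * complex.Re (wiener_phase s x) -
       (1 + cayley_re x) * complex.Im (wiener_phase s x))) /\
  is_derive x 1 (fun y => complex.Im (wiener_phase s y))
    (- (s / 2) * (cayley_im x * complex.Im (wiener_phase s x) +
       (1 + cayley_re x) * complex.Re (wiener_phase s x))).
Proof.
pose P (y : R) := 2 `^ (s / 2) * (1 + y ^+ 2) `^ (- (s / 2)).
pose t (y : R) := s / 2 * (pi + -2 * atan y).
have reE : (fun y => complex.Re (wiener_phase s y)) = (fun y => P y * cos (t y)).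
  by apply/funext => y; rewrite /wiener_phase /xmi_powN /P /t /= !mulNr; ring.
have imE : (fun y => complex.Im (wiener_phase s y)) = (fun y => P y * sin (t y)).
  by apply/funext => y; rewrite /wiener_phase /xmi_powN /P /t /= !mulNr; ring.
have rex : complex.Re (wiener_phase s x) = P x * cos (t x).
  exact: (congr1 (fun f : R -> R => f x) reE).
have imx : complex.Im (wiener_phase s x) = P x * sin (t x).
  exact: (congr1 (fun f : R -> R => f x) imE).
have dP := is_deriveZf (2 `^ (s / 2)) (is_derive_oneDsqr_powR (- (s / 2)) x).
have dt : is_derive x 1 t (- s / (1 + x ^+ 2)).
  apply: (is_derive_eq (is_deriveZf (s / 2) (is_deriveDf (is_derive_cstf pi x)
    (is_deriveZf (-2) (is_derive1_atan x))))).
  by field; exact: oneDsqr_neq0.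
have dc := @is_derive1_comp R cos t x _ _ (is_derive_cos _) dt.
have ds := @is_derive1_comp R sin t x _ _ (is_derive_sin _) dt.
rewrite rex imx; split; rewrite ?reE ?imE.
  apply: (is_derive_eq (is_deriveMf dP dc)).
  by rewrite oneD_cayley_re /cayley_im /P /=; field; exact: oneDsqr_neq0.
apply: (is_derive_eq (is_deriveMf dP ds)).
by rewrite oneD_cayley_re /cayley_im /P /=; field; exact: oneDsqr_neq0.
Qed.

(** The result is again a pair because sin^2 t = 1-r^2: after division by w, the terms even in x are
    polynomials in r and the odd ones are sin t times such polynomials. *)
Lemma is_cderive_pair_fun s F x :
  is_cderive (pair_fun s F) x ('i * pair_fun s (pair_op s F) x).
Proof.
have [dr di] := is_derive_wiener_phase s x.
have d1 := is_derive_horner_cayley F.1 x.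
have d2 := is_deriveMf (is_derive_cayley_im x) (is_derive_horner_cayley F.2 x).
pose wr y := complex.Re (wiener_phase s y).
pose wi y := complex.Im (wiener_phase s y).
pose e y := F.1.[cayley_re y].
pose o y := cayley_im y * F.2.[cayley_re y].
have reE : (fun y => complex.Re (pair_fun s F y)) = (fun y => wr y * e y + -1 * (wi y * o y)).
  apply/funext => y; rewrite /pair_fun /wr /wi /e /o.
  by case: (wiener_phase s y) => a b /=; rewrite mulN1r.
have imE : (fun y => complex.Im (pair_fun s F y)) = (fun y => wr y * o y + wi y * e y).
  apply/funext => y; rewrite /pair_fun /wr /wi /e /o.
  by case: (wiener_phase s y) => a b /=.
have re := is_deriveDf (is_deriveMf dr d1) (is_deriveZf (-1) (is_deriveMf di d2)).
have im := is_deriveDf (is_deriveMf dr d2) (is_deriveMf di d1).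
have A1 : (pair_op s F).1.[cayley_re x] =
  (1 + cayley_re x) * (cayley_re x * F.2.[cayley_re x] - cayley_im x ^+ 2 * F.2^`().[cayley_re x])
  - s / 2 * (cayley_im x ^+ 2 * F.2.[cayley_re x]) - s / 2 * ((1 + cayley_re x) * F.1.[cayley_re x]).
  rewrite cayley_norm /= !(hornerD, hornerN, hornerM, hornerZ, hornerXn, hornerX).
  by rewrite -polyC1 hornerC.
have A2 : (pair_op s F).2.[cayley_re x] =
  (1 + cayley_re x) * F.1^`().[cayley_re x] + s / 2 * F.1.[cayley_re x]
   - s / 2 * ((1 + cayley_re x) * F.2.[cayley_re x]).
  rewrite /= !(hornerD, hornerN, hornerM, hornerZ, hornerXn, hornerX).
  by rewrite -polyC1 hornerC.
rewrite /is_cderive reE imE; split.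
  apply: (is_derive_eq re); rewrite /pair_fun A1 A2.
  by case: (wiener_phase s x) => a b /=; ring.
apply: (is_derive_eq im); rewrite /pair_fun A1 A2.
by case: (wiener_phase s x) => a b /=; ring.
Qed.

Lemma wiener_phase_norm s x :
  complex.Re (wiener_phase s x) ^+ 2 + complex.Im (wiener_phase s x) ^+ 2 =
  wiener_weight s x.
Proof.
rewrite /wiener_phase /xmi_powN /wiener_weight /=; set t := s / 2 * _.
have -> : 2 `^ s = 2 `^ (s / 2) ^+ 2 :> R.
  by rewrite -powR_mulrn ?powR_ge0// -powRrM divfK.
have -> : (1 + x ^+ 2) `^ (- s) = (1 + x ^+ 2) `^ (- (s / 2)) ^+ 2.
  by rewrite -[RHS]powR_mulrn ?powR_ge0// -powRrM; congr (_ `^ _); field.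
rewrite -[RHS]mulr1 -(cos2Dsin2 t).
by ring.
Qed.

(** The real part of the integrand is odd in x and integrates to zero; the imaginary part is even
    and gives the form, with a minus sign from the conjugate of i. *)
Lemma inner_pair_fun s (hs : 1 / 2 < s) F G :
  inner (pair_fun s F) (fun x => 'i * pair_fun s G x) =
  0 +i* - pair_form (weight_functional hs) F G.
Proof.
rewrite /inner /cintegral.
pose p : {poly R} := F.2 * G.1 - F.1 * G.2.
pose q : {poly R} := F.1 * G.1 + (1 - 'X^2) * (F.2 * G.2).
have reE : (fun x => complex.Re (pair_fun s F x * ('i * pair_fun s G x)^*)) =
    (fun x => (cayley_im x * p.[cayley_re x]) * wiener_weight s x).
  apply/funext => x; rewrite -wiener_phase_norm /pair_fun /p.
  rewrite hornerD hornerN !hornerM.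
  by case: (wiener_phase s x) => a b /=; ring.
have imE : (fun x => complex.Im (pair_fun s F x * ('i * pair_fun s G x)^*)) =
    (fun x => (- q).[cayley_re x] * wiener_weight s x).
  apply/funext => x; rewrite -wiener_phase_norm /pair_fun /q.
  rewrite hornerN hornerD !hornerM.
  have -> : (1 - 'X^2 : {poly R}).[cayley_re x] = cayley_im x ^+ 2.
    by rewrite cayley_norm !hornerE.
  by case: (wiener_phase s x) => a b /=; ring.
rewrite reE imE; congr (_ +i* _).
  have [C C0 pC] := horner_bounded p.
  have ch : continuous (fun x => cayley_im x * p.[cayley_re x]).
    move=> x; apply: cvgM; last exact: continuous_horner_cayley.
    exact: (continuous_derive1 (@is_derive_cayley_im R)).
  apply: Rintegral_odd.
  - by move=> x; apply: cvgM; [exact: ch|exact: continuous_wiener_weight].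
  - apply: (@integrable_wiener_weight R s _ C) => // x.
    rewrite normrM -[leRHS]mul1r ler_pM//; last exact/pC/cayley_re_itv.
    rewrite -(@ler_pXn2r _ 2)// ?nnegrE// real_normK ?num_real// cayley_norm expr1n.
    by rewrite gerBl sqr_ge0.
  - by move=> x; rewrite cayley_imN cayley_reN /wiener_weight sqrrN !mulNr.
rewrite -[LHS]/(weight_functional hs (- q)) raddfN/=; congr (- _).
by rewrite /q raddfD.
Qed.

End PairFunctions.

(** * From quadratic forms to the spectral radius *)

Lemma sum_complex (R : realType) (I : finType) (f g : I -> R) :
  \sum_i (f i +i* g i) = (\sum_i f i) +i* (\sum_i g i).
Proof. by elim/big_rec3: _ => // i a b c _ ->. Qed.

Lemma imag_complex (R : realType) (c : R) : 0 +i* c = 'i * c%:C.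
Proof.
by apply/eqP; rewrite eq_complex/=; apply/andP; split; apply/eqP; ring.
Qed.

(* The matrix is - i times a real symmetric one, so the real and imaginary parts
   of an eigenvector contribute separately to the quadratic form. *)
Lemma spectral_radius_le (R : realType) (n : nat) (A : 'I_n -> 'I_n -> R) (K : R) :
  0 <= K ->
  (forall i j, A i j = A j i) ->
  (forall x : 'I_n -> R,
    `|\sum_i \sum_j x i * x j * A i j| <= K * \sum_i x i ^+ 2) ->
  spectral_radius (\matrix_(i, j) (0 +i* - A i j) : 'M[R[i]]_n) <= K.
Proof.
move=> K0 symA qA; rewrite /spectral_radius.
set Z := [set complex.Re `|z| | z in _].
have ubZ : ubound Z K.
  move=> _ [z /= /eigenvalueP[v vA v0] <-].
  pose x i := complex.Re (v 0 i); pose y i := complex.Im (v 0 i).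
  pose n2 := \sum_i (x i ^+ 2 + y i ^+ 2).
  have n2_gt0 : 0 < n2.
    have [j vj] : exists j, v 0 j != 0.
      apply/existsP; apply: contraNT v0; rewrite negb_exists => /forallP h.
      by apply/eqP/rowP => j; rewrite mxE; move: (h j); rewrite negbK => /eqP.
    rewrite /n2 (bigD1 j)//= ltr_pwDl ?sumr_ge0//; last first.
      by move=> i _; rewrite addr_ge0 ?sqr_ge0.
    rewrite lt_def addr_ge0 ?sqr_ge0// andbT.
    apply: contraNneq vj => /eqP; rewrite paddr_eq0 ?sqr_ge0// !sqrf_eq0.
    by rewrite eq_complex.
  pose Q (u : 'I_n -> R) := \sum_i \sum_j u i * u j * A i j.
  (* The eigenvector equation is tested against the conjugate of v. The cross terms between real and
     imaginary parts are antisymmetric in (i, j), so they cancel in the double sum. *)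
  have key : z * n2%:C = 0 +i* - (Q x + Q y).
    have e1 j : z * (v 0 j * (v 0 j)^*) =
        \sum_i v 0 i * (0 +i* - A i j) * (v 0 j)^*.
      have := congr1 (fun M : 'rV_n => M 0 j) vA; rewrite !mxE => e.
      rewrite mulrA -e mulr_suml; apply: eq_bigr => i _.
      by rewrite mxE.
    have -> : z * n2%:C = \sum_j z * (v 0 j * (v 0 j)^*).
      rewrite -mulr_sumr; congr (_ * _); rewrite /n2 rmorph_sum/=.
      apply: eq_bigr => j _; rewrite /x /y; case: (v 0 j) => a b /=.
      by apply/eqP; rewrite eq_complex/=; apply/andP; split; apply/eqP; ring.
    under eq_bigr do rewrite e1.
    pose B i j := A i j * (y i * x j - x i * y j).
    have -> : \sum_j \sum_i v 0 i * (0 +i* - A i j) * (v 0 j)^* =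
        \sum_j \sum_i (B i j +i* - ((x i * x j + y i * y j) * A i j)).
      apply: eq_bigr => j _; apply: eq_bigr => i _; rewrite /B /x /y.
      case: (v 0 i) (v 0 j) => a b [c d] /=.
      by apply/eqP; rewrite eq_complex/=; apply/andP; split; apply/eqP; ring.
    under eq_bigr do rewrite sum_complex.
    rewrite sum_complex; congr (_ +i* _).
      have BC : \sum_j \sum_i B i j = - \sum_j \sum_i B i j.
        rewrite [LHS]exchange_big -sumrN/=; apply: eq_bigr => i _.
        rewrite -sumrN; apply: eq_bigr => j _.
        by rewrite /B symA; ring.
      by apply/eqP; rewrite -eqNr -BC.
    rewrite /Q -big_split/= -sumrN exchange_big/=; apply: eq_bigr => i _.
    rewrite -big_split/= -sumrN; apply: eq_bigr => j _.
    by rewrite mulrDl.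
  have zn : `|z| * n2%:C = `|Q x + Q y|%:C.
    rewrite -[n2%:C]ger0_norm ?ler0c ?(ltW n2_gt0)// -normrM key normc_def/=.
    by rewrite expr0n add0r sqrrN sqrtr_sqr.
  have qxy : `|Q x + Q y| <= K * n2.
    rewrite /n2 big_split/= mulrDr (le_trans (ler_normD _ _))// lerD//; exact: qA.
  have zr : `|z| = (complex.Re `|z|)%:C by rewrite normc_def.
  rewrite -(ler_pM2r n2_gt0); suff -> : complex.Re `|z| * n2 = `|Q x + Q y| by [].
  by apply: complexI; rewrite rmorphM/= -zr zn.
(* For an empty set of eigenvalues, as when [n = 0], [sup] takes the default value 0, which is
   covered by [0 <= K]. *)
have [Zn0|Z0] := pselect (Z !=set0); first exact: ge_sup.
by rewrite (_ : Z = set0) ?sup0//; apply/eqP/negPn/negP => /set0P.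
Qed.

(** * The stiffness matrix *)

Section Main.
Variables (R : realType) (s : R).
Hypothesis hs : 1 / 2 < s.

Let L : {scalar {poly R}} := weight_functional hs.
Let nu n := (jacobi_norm (- (1 / 2)) (s - 3 / 2) n)^-1.
Let eta n := (jacobi_norm (1 / 2) (s - 1 / 2) n)^-1.
Let wp := wiener_pair s nu eta.

Let pL : pearson (- (1 / 2)) (s - 3 / 2) L.
Proof. exact: weight_functional_pearson. Qed.

Let L0 : 0 < L 1. Proof. exact: weight_functional1_gt0. Qed.

Let nuE n : nu n ^+ 2 * L (jacobi (- (1 / 2)) (s - 3 / 2) n ^+ 2) = 2.
Proof.
have h : 0 < L (jacobi (- (1 / 2)) (s - 3 / 2) n ^+ 2).
  by rewrite expr2; apply: (jacobi_sqr_gt0 _ _ _ pL L0); have := hs; lra.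
rewrite /nu (jacobi_normE hs) exprVn sqr_sqrtr ?divr_ge0 ?(ltW h)//.
by rewrite invf_div -mulrA mulVf ?gt_eqF// mulr1.
Qed.

Let etaE n : eta n ^+ 2 * wshift L (jacobi (1 / 2) (s - 1 / 2) n ^+ 2) = 2.
Proof.
have h : 0 < wshift L (jacobi (1 / 2) (s - 1 / 2) n ^+ 2).
  have p1 := pearson_shift pL.
  have a1 : -1 < - (1 / 2) :> R by lra.
  have b1 : -1 < s - 3 / 2 :> R by have := hs; lra.
  have g1 := wshift_gt0 a1 b1 pL L0.
  have ea : - (1 / 2) + 1 = 1 / 2 :> R by field.
  have eb : s - 3 / 2 + 1 = s - 1 / 2 by field.
  rewrite ea eb in p1.
  by rewrite expr2; apply: (jacobi_sqr_gt0 _ _ _ p1 g1); have := hs; lra.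
rewrite /eta (jacobi_norm_shiftE hs) exprVn sqr_sqrtr ?divr_ge0 ?(ltW h)//.
by rewrite invf_div -mulrA mulVf ?gt_eqF// mulr1.
Qed.

Definition stiffness_coef := wiener_mat s L nu eta.
Let A := stiffness_coef.

Let phiE k : wiener_phi s k = pair_fun s (wp k).
Proof. by apply/funext => x; rewrite wiener_phiE. Qed.

Let dphiE k : cderive (wiener_phi s k) =
  (fun x => 'i * pair_fun s (pair_op s (wp k)) x).
Proof.
apply/funext => x; rewrite phiE /cderive.
have [dr di] := is_cderive_pair_fun s (wp k) x.
rewrite !derive1E; case: dr => _ ->; case: di => _ ->.
by case: ('i * _).
Qed.

Lemma wiener_phi_deriv k x : is_cderive (wiener_phi s k) x
  (\sum_(l <- nbrs k) (0 +i* A k l) * wiener_phi s l x).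
Proof.
have -> : \sum_(l <- nbrs k) (0 +i* A k l) * wiener_phi s l x =
    'i * pair_fun s (pair_op s (wp k)) x.
  rewrite (pair_op_nbrs hs pL nuE etaE) pair_fun_sum mulr_sumr.
  apply: eq_bigr => l _; rewrite phiE [RHS]mulrA; congr (_ * _).
  exact: imag_complex.
rewrite phiE; exact: is_cderive_pair_fun.
Qed.

Lemma stiffnessE N k0 : stiffness s N k0 =
  \matrix_(i, j) (0 +i* - A (idx k0 i) (idx k0 j)).
Proof.
apply/matrixP => i j; rewrite !mxE dphiE phiE (inner_pair_fun hs).
by rewrite -(pair_op_sym pL).
Qed.

Lemma stiffness_coefC k l : A k l = A l k.
Proof. exact: wiener_matC. Qed.

Lemma stiffness_coef_sparse k l : l \notin nbrs k -> A k l = 0.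
Proof. exact: wiener_mat_sparse. Qed.

Lemma stiffness_coef_bound (n m : nat) (ix : 'I_n -> int) (x : 'I_n -> R) :
  injective ix -> (forall i, (`|ix i| <= m)%N) ->
  `|\sum_i \sum_j x i * x j * A (ix i) (ix j)| <=
  (2 * m%:R + 7 / 2 * s) * \sum_i x i ^+ 2.
Proof.
move=> ixI ixm; apply: (wiener_mat_bound hs pL nuE etaE) => //.
exact: weight_functional_ge0.
Qed.

End Main.

Theorem theorem2 (R : realType) (s : R) (hs : 1 / 2 < s)
    (N : nat) (hN : (1 <= N)%N) (k0 : int)
    (hlo : - (N./2)%:Z <= k0) (hhi : k0 + (N%:Z - 1) <= (N./2)%:Z) :
  let S : 'M[R[i]]_N := stiffness s N k0 in
  (forall i j : 'I_N, S i j = - (S j i)^*) /\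
  ((exists tau : int -> int -> R[i],
      (forall k l : int, complex.Re (tau k l) = 0) /\
      (forall (k : int) (x : R),
         is_cderive (wiener_phi s k) x
           (\sum_(l <- nbrs k) tau k l * wiener_phi s l x))) /\
   (forall i j : 'I_N, idx k0 j \notin nbrs (idx k0 i) -> S i j = 0)) /\
  spectral_radius S <= N%:R + 5 * s.
Proof.
move=> S; have SE : S = \matrix_(i, j) (0 +i* - stiffness_coef hs (idx k0 i) (idx k0 j)).
  exact: stiffnessE.
split; [|split; [split|]].
- move=> i j; rewrite SE !mxE stiffness_coefC.
  by apply/eqP; rewrite eq_complex/= oppr0 opprK !eqxx.
- exists (fun k l => 0 +i* stiffness_coef hs k l); split=> // k x.
  exact: wiener_phi_deriv.
- by move=> i j ij; rewrite SE mxE stiffness_coef_sparse// oppr0.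
have s0 : 0 < s by lra.
have idxI : injective (@idx N k0) by move=> i j /addrI[] /val_inj.
have idxN (i : 'I_N) : (`|idx k0 i| <= N./2)%N.
  by rewrite /idx; move: (nat_of_ord i) (ltn_ord i) (N./2) hlo hhi => n nN h; lia.
have NN : 2 * (N./2)%:R <= N%:R :> R by rewrite -natrM ler_nat; lia.
apply: (@le_trans _ _ (2 * (N./2)%:R + 7 / 2 * s)); last by lra.
rewrite SE; apply: (@spectral_radius_le R N
  (fun i j => stiffness_coef hs (idx k0 i) (idx k0 j))).
- by rewrite addr_ge0 ?mulr_ge0// ltW.
- by move=> i j; exact: stiffness_coefC.
- by move=> x; exact: stiffness_coef_bound.
Qed.
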